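(* There exist infinite measure preserving transformations $T$ that are weakly rationally ergodic, but are not rationally ergodic.
   Context: Transformations are invertible and measure preserving on $\sigma$-finite, nonatomic Lebesgue measure spaces $(X,\mu)$; ''infinite measure preserving'' means $\mu(X)=\infty$. $I_F$ is the indicator function of $F$. $T$ is rationally ergodic if it is conservative ergodic and there exists a set $F$ of positive finite measure such that $\liminf_{n\to\infty}\frac{(\int_F\sum_{i=0}^{n-1}I_F(T^ix)\,d\mu)^2}{\int_F(\sum_{i=0}^{n-1}I_F(T^ix))^2 d\mu}>0$. $T$ is weakly rationally ergodic if it is conservative ergodic and there exists a set $F$ of positive finite measure such that, with $a_n(F)=\sum_{k=0}^{n-1}\mu(F\cap T^kF)/\mu(F)^2$, one has $\lim_{n\to\infty}\frac{1}{a_n(F)}\sum_{k=0}^{n-1}\mu(A\cap T^kB)=\mu(A)\mu(B)$ for all measurable $A,B\subset F$. *)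

(* Defs.v *)
From HB Require Import structures.
From mathcomp Require Import all_boot all_order all_algebra.
From mathcomp Require Import all_classical all_reals all_analysis.
From mathcomp Require Import measurable_realfun.

Set Implicit Arguments.
Unset Strict Implicit.
Unset Printing Implicit Defensive.

Import Order.TTheory GRing.Theory Num.Theory.
Import numFieldNormedType.Exports.

Local Open Scope classical_set_scope.
Local Open Scope ring_scope.
Local Open Scope ereal_scope.

(* Lebesgue measure on an interval I, plus countably many point masses w x at
   the points x of a set D disjoint from I. *)
Definition interval_with_atoms (R : realType)
    (nu : {measure set (measurableTypeR R) -> \bar R}) : Prop :=
  exists (I D : set R) (w : R -> R),
    [/\ is_interval I, countable D, I `&` D = set0,
        (forall x, D x -> (0 < w x)%R) &
        forall B : set (measurableTypeR R), measurable B ->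
          nu B = lebesgue_measure (B `&` I) + \esum_(x in B `&` D) (w x)%:E].

(* phi is an isomorphism, after discarding null sets, from (X, mu) onto the
   completion of the Borel measure space (R, nu). As measurability is required
   in both directions, (X, mu) is necessarily complete. *)
Definition isomorphic_mod0_completion (R : realType)
    (d : measure_display) (X : measurableType d)
    (mu : {measure set X -> \bar R})
    (nu : {measure set (measurableTypeR R) -> \bar R}) : Prop :=
  exists (N : set X) (phi : X -> measurableTypeR R),
    [/\ mu.-negligible N,
        {in ~` N &, injective phi},
        nu.-negligible (~` (phi @` (~` N))),
        (forall A : set X,
          measurable A <-> completed_algebra_gen nu (phi @` (A `\` N))) &
        forall B : set (measurableTypeR R), measurable B ->
          mu (phi @^-1` B `\` N) = nu B].

(* Rokhlin's definition. *)
Definition lebesgue_space (R : realType) (d : measure_display)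
    (X : measurableType d) (mu : {measure set X -> \bar R}) : Prop :=
  exists nu : {measure set (measurableTypeR R) -> \bar R},
    interval_with_atoms nu /\ isomorphic_mod0_completion mu nu.

Definition nonatomic (R : realType) (d : measure_display)
    (X : measurableType d) (mu : {measure set X -> \bar R}) : Prop :=
  forall A : set X, measurable A -> 0 < mu A ->
    exists B : set X, [/\ measurable B, B `<=` A, 0 < mu B & mu B < mu A].

Definition invertible_measure_preserving (R : realType) (d : measure_display)
    (X : measurableType d) (mu : {measure set X -> \bar R})
    (T : X -> X) : Prop :=
  [/\ (exists S : X -> X,
        [/\ cancel T S, cancel S T & measurable_fun setT S]),
      measurable_fun setT T &
      forall A : set X, measurable A -> mu (T @^-1` A) = mu A].

(* No wandering set has positive measure. *)
Definition conservative (R : realType) (d : measure_display)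
    (X : measurableType d) (mu : {measure set X -> \bar R})
    (T : X -> X) : Prop :=
  forall W : set X, measurable W ->
    trivIset setT (fun n : nat => iter n T @^-1` W) -> mu W = 0.

Definition ergodic (R : realType) (d : measure_display)
    (X : measurableType d) (mu : {measure set X -> \bar R})
    (T : X -> X) : Prop :=
  forall A : set X, measurable A -> T @^-1` A = A ->
    mu A = 0 \/ mu (~` A) = 0.

Definition visits (R : realType) (X : Type) (T : X -> X) (F : set X)
    (n : nat) (x : X) : \bar R :=
  \sum_(0 <= i < n) (\1_F (iter i T x))%:E.

Definition rationally_ergodic (R : realType) (d : measure_display)
    (X : measurableType d) (mu : {measure set X -> \bar R})
    (T : X -> X) : Prop :=
  [/\ conservative mu T, ergodic mu T &
      exists F : set X,
        [/\ measurable F, 0 < mu F, mu F < +oo &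
            0 < limn_einf (fun n : nat =>
                  (\int[mu]_(x in F) visits R T F n x) ^+ 2
                  / \int[mu]_(x in F) (visits R T F n x ^+ 2))]].

Definition intrinsic_weight (R : realType) (d : measure_display)
    (X : measurableType d) (mu : {measure set X -> \bar R})
    (T : X -> X) (F : set X) (n : nat) : \bar R :=
  \sum_(0 <= k < n) (mu (F `&` (iter k T @` F)) / (mu F ^+ 2)).

Definition weakly_rationally_ergodic (R : realType) (d : measure_display)
    (X : measurableType d) (mu : {measure set X -> \bar R})
    (T : X -> X) : Prop :=
  [/\ conservative mu T, ergodic mu T &
      exists F : set X,
        [/\ measurable F, 0 < mu F, mu F < +oo &
            forall A B : set X, measurable A -> measurable B ->
              A `<=` F -> B `<=` F ->
              (fun n : nat => (intrinsic_weight mu T F n)^-1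
                 * \sum_(0 <= k < n) mu (A `&` (iter k T @` B))) @ \oo
                --> mu A * mu B]].

(* Main.v *)
Require Import Defs.
From HB Require Import structures.
From mathcomp Require Import all_boot all_order all_algebra.
From mathcomp Require Import all_classical all_reals all_analysis.
From mathcomp Require Import perm measurable_realfun ring lra zify.

Set Implicit Arguments.
Unset Strict Implicit.
Unset Printing Implicit Defensive.

Import Order.TTheory GRing.Theory Num.Theory.
Import numFieldNormedType.Exports.

Local Open Scope classical_set_scope.
Local Open Scope ring_scope.

(** A rank-one (cutting and stacking) transformation of the line. The [N]-th
    column is cut into [pp N * qq N] copies; the first [pp N] of them are stacked
    without gaps and form a "burst", of relative measure [1 / qq N], and the
    others are placed at equal large distances [gap N]. Up to a time [n] of the
    order of the height of the [N.+1]-st column, a typical point of the base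
    returns at most about [RR N * (n / gap N + 1)] times, while a point of the
    burst may return [pp N] times more often.

    Since [pp N / qq N] tends to 0, the bursts are negligible in mean, so the
    normalised return counts are uniformly integrable. For two levels of a same
    column, the correlation sums differ by a bounded amount because the levels
    are translates of each other. Together these give the ratio limit for all
    subsets of the base.

    Since [pp N ^ 2 / qq N] tends to infinity, at time [gap N] the second moment
    is dominated by the burst. As the bursts are independent and [1 / qq N] is
    not summable, any set of positive measure occupies a fixed proportion of
    infinitely many bursts, and the second moment inequality defining rational
    ergodicity fails for every set. *)

(** * Sets of finite measure *)

Section FiniteMeasure.
Context d (X : measurableType d) (R : realType) (mu : {measure set X -> \bar R}).

(** The conditions that [pp / qq] tends to 0, that [pp ^ 2 / qq] tends to infinity and that [1 / qq]
    is not summable are met by [qq = N + 1] and [pp] of order [qq ^ (2 / 3)]. At time [gap N] the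
    first moment is at most of order [RR N], while a part [H] of the burst forces a second moment of
    order [m H ^ 3 * (RR N * pp * qq) ^ 2]. With [m H >= kappa / qq] this is at least
    [kappa ^ 3 * RR N ^ 2 * pp ^ 2 / qq].

    For an arbitrary set [H] visits cannot be bounded below by counting levels. Cauchy-Schwarz
    replaces counting: if the first [n] preimages of [H] stay inside [P], they overlap, and the
    visits add up to at least [n * m H ^ 2 / (2 * m P)].

    A set [F] tested for rational ergodicity need not lie in a column. The second moment inequality
    assumed for [F] itself allows the part of [F] outside a large column to be discarded. *)

Definition fin_meas (A : set X) := measurable A /\ (mu A < +oo)%E.
Definition meas (A : set X) : R := fine (mu A).
Local Notation m := meas.
Local Notation fm := fin_meas.

Lemma fin_measE A : fm A -> mu A = (m A)%:E.
Proof. by case=> mA Aoo; rewrite /meas fineK// ge0_fin_numE. Qed.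

Lemma meas_ge0 A : 0 <= m A. Proof. exact: fine_ge0. Qed.

Lemma meas0 : m set0 = 0. Proof. by rewrite /meas measure0. Qed.

Lemma fin_meas_sub A B : fm B -> measurable A -> A `<=` B -> fm A.
Proof.
move=> [mB Boo] mA AB; split => //; apply: le_lt_trans Boo.
by apply: le_measure; rewrite ?inE.
Qed.

Lemma fin_measI A B : fm A -> measurable B -> fm (A `&` B).
Proof. by move=> fA mB; apply: (fin_meas_sub fA); [case: fA => mA _; exact: measurableI|move=> x []]. Qed.

Lemma fin_measIr A B : fm A -> measurable B -> fm (B `&` A).
Proof. by move=> fA mB; rewrite setIC; exact: fin_measI. Qed.

Lemma fin_measD A B : fm A -> measurable B -> fm (A `\` B).
Proof. by move=> fA mB; apply: (fin_meas_sub fA); [case: fA => mA _; exact: measurableD|move=> x []]. Qed.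

Lemma fin_measU A B : fm A -> fm B -> fm (A `|` B).
Proof.
move=> [mA Aoo] [mB Boo]; split; first exact: measurableU.
by apply: (le_lt_trans (measureU2 mu mA mB)); rewrite lte_add_pinfty.
Qed.

Lemma fin_meas0 : fm set0. Proof. by split; [exact: measurable0|rewrite measure0]. Qed.

Lemma le_meas A B : fm B -> measurable A -> A `<=` B -> m A <= m B.
Proof.
move=> fB mA AB; have fA := fin_meas_sub fB mA AB.
by rewrite -lee_fin -!fin_measE//; apply: le_measure; rewrite ?inE//; case: fB.
Qed.

Lemma measU A B : fm A -> fm B -> (forall x, A x -> B x -> False) ->
  m (A `|` B) = m A + m B.
Proof.
move=> fA fB AB0; apply: EFin_inj; rewrite EFinD -!fin_measE//; last exact: fin_measU.
case: fA fB => mA _ [mB _]; rewrite measureU//.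
by apply/seteqP; split=> // x [/AB0].
Qed.

Lemma measU_le A B : fm A -> fm B -> m (A `|` B) <= m A + m B.
Proof.
move=> fA fB; rewrite -lee_fin EFinD -!fin_measE//; last exact: fin_measU.
by case: fA fB => mA _ [mB _]; exact: measureU2.
Qed.

Lemma meas_split A B : fm A -> measurable B -> m A = m (A `&` B) + m (A `\` B).
Proof.
move=> fA mB; rewrite -measU; [by rewrite setUIDK| | |].
- exact: fin_measI.
- exact: fin_measD.
- by move=> x [_ ?] [_].
Qed.

Lemma fin_meas_bigcup n (F : nat -> set X) : (forall i, (i < n)%N -> fm (F i)) ->
  fm (\bigcup_(i in `I_n) F i).
Proof.
elim: n => [|n ih] h; first by rewrite II0 bigcup_set0; exact: fin_meas0.
rewrite IIS bigcup_setU bigcup_set1; apply: fin_measU; last exact: h.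
by apply: ih => i ni; apply: h; exact: ltnW.
Qed.

Lemma meas_bigcup_le n (F : nat -> set X) : (forall i, (i < n)%N -> fm (F i)) ->
  m (\bigcup_(i in `I_n) F i) <= \sum_(i < n) m (F i).
Proof.
elim: n => [|n ih] h; first by rewrite II0 bigcup_set0 meas0 big_ord0.
have h' i : (i < n)%N -> fm (F i) by move=> ni; apply: h; exact: ltnW.
rewrite IIS bigcup_setU bigcup_set1 big_ord_recr/=.
apply: le_trans (lerD (ih h') (lexx _)).
by apply: measU_le; [exact: fin_meas_bigcup|exact: h].
Qed.

Lemma sum_meas_disjoint n (F : nat -> set X) B : fm B ->
  (forall i, (i < n)%N -> measurable (F i)) ->
  (forall i j x, (i < j < n)%N -> F i x -> F j x -> False) ->
  \sum_(i < n) m (B `&` F i) = m (B `&` \bigcup_(i in `I_n) F i).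
Proof.
move=> fB; elim: n => [|n ih] mF dF.
  by rewrite II0 bigcup_set0 setI0 meas0 big_ord0.
have mF' i : (i < n)%N -> measurable (F i) by move=> ni; apply: mF; exact: ltnW.
rewrite big_ord_recr/= ih//; last first.
  by move=> i j x /andP[ij jn]; apply: dF; rewrite ij ltnW.
rewrite IIS bigcup_setU bigcup_set1 setIUr measU//.
- apply: fin_measI => //; apply: bigcup_measurable => // i; exact: mF'.
- by apply: fin_measI => //; exact: mF.
- by move=> x [_ [i /= ni Fix]] [_]; apply: (dF i) => //; rewrite ni ltnSn.
Qed.

Lemma sum_meas_disjoint_le n (F : nat -> set X) B : fm B ->
  (forall i, (i < n)%N -> measurable (F i)) ->
  (forall i j x, (i < j < n)%N -> F i x -> F j x -> False) ->
  \sum_(i < n) m (B `&` F i) <= m B.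
Proof.
move=> fB mF dF; rewrite sum_meas_disjoint//; apply: le_meas => //.
by apply: measurableI; [case: fB|apply: bigcup_measurable].
Qed.

Lemma sum_meas_cover n (F : nat -> set X) B : fm B ->
  (forall i, (i < n)%N -> measurable (F i)) ->
  (forall i j x, (i < j < n)%N -> F i x -> F j x -> False) ->
  B `<=` \bigcup_(i in `I_n) F i ->
  \sum_(i < n) m (B `&` F i) = m B.
Proof. by move=> fB mF dF BF; rewrite sum_meas_disjoint// setIidl. Qed.

Lemma measurable_sum_indic n (A : nat -> set X) D :
  (forall i, measurable (A i)) ->
  measurable_fun D (fun x => \sum_(i < n) \1_(A i) x : R).
Proof. by move=> mA; apply: measurable_sum => i; exact: measurable_indic. Qed.

Lemma integral_sum_indic n (A : nat -> set X) D : fm D ->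
  (forall i, measurable (A i)) ->
  (\int[mu]_(x in D) (\sum_(i < n) \1_(A i) x)%:E =
   (\sum_(i < n) m (D `&` A i))%:E)%E.
Proof.
move=> fD mA; under eq_integral do rewrite -sumEFin.
rewrite ge0_integral_sum//=; [|by case: fD|].
- rewrite -sumEFin; apply: eq_bigr => i _.
  by rewrite integral_indic//; [rewrite setIC fin_measE//; exact: fin_measI|case: fD].
- by move=> i; apply/measurable_EFinP; exact: measurable_indic.
Qed.

Lemma integral_sum_indic_sqr n (A : nat -> set X) D : fm D ->
  (forall i, measurable (A i)) ->
  (\int[mu]_(x in D) ((\sum_(i < n) \1_(A i) x) ^+ 2)%:E =
   (\sum_(i < n) \sum_(j < n) m (D `&` A i `&` A j))%:E)%E.
Proof.
move=> fD mA.
have mAA i j : measurable (A i `&` A j) by exact: measurableI.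
transitivity (\int[mu]_(x in D)
   \sum_(i < n) \sum_(j < n) (\1_(A i `&` A j) x : R)%:E)%E.
  apply: eq_integral => x _; rewrite expr2 mulr_suml -sumEFin.
  apply: eq_bigr => i _; rewrite mulr_sumr -sumEFin.
  by apply: eq_bigr => j _; rewrite indicI.
rewrite ge0_integral_sum//=; [|by case: fD| |].
- rewrite -sumEFin; apply: eq_bigr => i _.
  under eq_integral do rewrite sumEFin.
  rewrite (integral_sum_indic n fD (mAA i)); congr (_%:E).
  by apply: eq_bigr => j _; rewrite setIA.
- move=> i; apply: emeasurable_sum => j.
  by apply/measurable_EFinP; exact: measurable_indic.
- by move=> i x _; apply: sume_ge0 => j _; rewrite lee_fin.
Qed.

(* Cauchy-Schwarz for the function counting the sets A i a point belongs to. *)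
Lemma sum_meas_sqr_le n (A : nat -> set X) P : fm P ->
  (forall i, measurable (A i)) -> (forall i, (i < n)%N -> A i `<=` P) ->
  (\sum_(i < n) m (A i)) ^+ 2 <=
  m P * \sum_(i < n) \sum_(j < n) m (A i `&` A j).
Proof.
move=> fP mA AP.
set s := \sum_(i < n) m (A i); set q := \sum_(i < n) \sum_(j < n) _.
have s0 : 0 <= s by apply: sumr_ge0 => i _; exact: meas_ge0.
(* Integrate [0 <= (t - f) ^ 2] over [P], where [f] counts the sets. In the form
   [2 * t * f <= t ^ 2 + f ^ 2] with [0 <= t] both sides are nonnegative. The mean value
   [t := s / m P] then gives the claim. *)
have key t : 0 <= t -> 2 * t * s <= t ^+ 2 * m P + q.
  move=> t0.
  have Is := integral_sum_indic n fP mA.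
  have Iq := integral_sum_indic_sqr n fP mA.
  have sE : \sum_(i < n) m (P `&` A i) = s.
    by apply: eq_bigr => i _; rewrite setIidr//; exact: AP.
  have qE : \sum_(i < n) \sum_(j < n) m (P `&` A i `&` A j) = q.
    by apply: eq_bigr => i _; rewrite setIidr//; exact: AP.
  rewrite sE in Is; rewrite qE in Iq.
  have mf : measurable_fun P (fun x => \sum_(i < n) \1_(A i) x : R).
    exact: measurable_sum_indic.
  set f := fun x => \sum_(i < n) \1_(A i) x : R.
  have f0 x : 0 <= f x by apply: sumr_ge0.
  have mP : measurable P by case: fP.
  rewrite -lee_fin EFinD (EFinM (2 * t)) (EFinM (t ^+ 2)) -Is -Iq -(fin_measE fP).
  rewrite -(integral_cst mu mP).
  rewrite -ge0_integralZl_EFin//; last 3 first.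
  - by move=> x _; rewrite lee_fin; exact: f0.
  - exact/measurable_EFinP.
  - by rewrite mulr_ge0.
  rewrite -ge0_integralD//; last 3 first.
  - by move=> x _; rewrite /= lee_fin sqr_ge0.
  - by move=> x _; rewrite lee_fin sqr_ge0.
  - by apply/measurable_EFinP; exact: measurable_funX.
  apply: ge0_le_integral => //.
  - by move=> x _; rewrite -EFinM lee_fin !mulr_ge0// f0.
  - by apply: measurable_funeM; exact/measurable_EFinP.
  - apply: emeasurable_funD => //.
    by apply/measurable_EFinP; exact: measurable_funX.
  - move=> x _; rewrite -EFinM -EFinD lee_fin -/(f x).
    by rewrite -subr_ge0 (_ : _ - _ = (t - f x) ^+ 2) ?sqr_ge0//; ring.
have [mP0|mP0] := eqVneq (m P) 0.
  suff -> : s = 0 by rewrite expr0n/= mP0 mul0r.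
  apply: big1 => i _; apply/eqP; rewrite eq_le meas_ge0 andbT -mP0.
  by apply: le_meas => //; exact: AP.
have P0 : 0 < m P by rewrite lt_neqAle eq_sym mP0 meas_ge0.
have := key (s / m P) (divr_ge0 s0 (meas_ge0 _)).
rewrite -(ler_pM2l P0).
rewrite (_ : m P * (2 * (s / m P) * s) = 2 * s ^+ 2); last by field.
rewrite mulrDr (_ : m P * ((s / m P) ^+ 2 * m P) = s ^+ 2); last by field.
by move: (m P * q) => z; lra.
Qed.

End FiniteMeasure.

(** * Visit counts of a measure preserving transformation *)

Section MeasurePreserving.
Context d (X : measurableType d) (R : realType) (mu : {measure set X -> \bar R}).
Local Notation m := (meas mu).
Local Notation fm := (fin_meas mu).

(** Carrying the inverse makes the notion symmetric, so bounds proved for [T] pass to [S] by time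
    reversal. *)
Definition inverse_mp (T S : X -> X) :=
  [/\ cancel T S, cancel S T, measurable_fun setT T, measurable_fun setT S &
      forall A, measurable A -> mu (T @^-1` A) = mu A].

Lemma inverse_mp_sym T S : inverse_mp T S -> inverse_mp S T.
Proof.
move=> [TS ST mT mS muT]; split => // A mA; rewrite -[LHS]muT; last first.
  by rewrite -[X in measurable X]setTI; exact: mS.
by rewrite -comp_preimage (_ : S \o T = id) ?preimage_id//; apply/funext => x /=.
Qed.

Lemma iter_cancel (T S : X -> X) k : cancel T S -> cancel (iter k T) (iter k S).
Proof. by move=> TS; elim: k => // k ih x; rewrite iterSr iterS TS ih. Qed.

(** The integral over [B] of the number of visits to [A] before time [n]. *)
Definition visit_sum (T : X -> X) n (B A : set X) : R :=
  \sum_(k < n) m (B `&` iter k T @^-1` A).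

Local Notation hits := visit_sum.

(** The second moment: the integral over [A] of the squared number of visits to [A]. *)
Definition hits2 (T : X -> X) n (A : set X) : R :=
  \sum_(i < n) \sum_(j < n) m (A `&` iter i T @^-1` A `&` iter j T @^-1` A).

Definition spaced (T : X -> X) g (A : set X) :=
  forall j x, (0 < j < g)%N -> A x -> A (iter j T x) -> False.

Section Pair.
Variables T S : X -> X.
Hypothesis TS : inverse_mp T S.

Lemma measurable_iter k A : measurable A -> measurable (iter k T @^-1` A).
Proof.
move=> mA; elim: k => [//|k ih] /=.
have [_ _ mT _ _] := TS.
rewrite (_ : _ @^-1` A = T @^-1` (iter k T @^-1` A)).
  by rewrite -[X in measurable X]setTI; exact: mT.
by apply/seteqP; split => x /=; rewrite -iterS iterSr.
Qed.

Lemma mu_iter k A : measurable A -> mu (iter k T @^-1` A) = mu A.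
Proof.
move=> mA; elim: k => [//|k ih] /=; have [_ _ mT _ muT] := TS.
rewrite (_ : _ @^-1` A = T @^-1` (iter k T @^-1` A)).
  by rewrite muT//; exact: measurable_iter.
by apply/seteqP; split => x /=; rewrite -iterS iterSr.
Qed.

Lemma fin_meas_iter k A : fm A -> fm (iter k T @^-1` A).
Proof. by move=> [mA Aoo]; split; [exact: measurable_iter|rewrite mu_iter]. Qed.

Lemma meas_iter k A : measurable A -> m (iter k T @^-1` A) = m A.
Proof. by move=> mA; rewrite /meas mu_iter. Qed.

Lemma iter_setI k A B :
  iter k T @^-1` (A `&` B) = iter k T @^-1` A `&` iter k T @^-1` B.
Proof. exact: preimage_setI. Qed.

Lemma iterD_preimage i j A :
  iter i T @^-1` (iter j T @^-1` A) = iter (i + j) T @^-1` A.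
Proof. by apply/seteqP; split => x /=; rewrite -iterD addnC. Qed.

Lemma iterK_preimage i j A :
  (i <= j)%N -> iter j T @^-1` (iter i S @^-1` A) = iter (j - i) T @^-1` A.
Proof.
move=> ij; have [TK _ _ _ _] := TS.
have E x : iter i S (iter j T x) = iter (j - i) T x.
  by rewrite -{1}(subnKC ij) iterD (iter_cancel i TK).
by apply/seteqP; split => x /=; rewrite E.
Qed.

End Pair.

Lemma meas_dual T S k B A : inverse_mp T S -> measurable B -> measurable A ->
  m (B `&` iter k T @^-1` A) = m (A `&` iter k S @^-1` B).
Proof.
move=> TS mB mA.
have mC : measurable (A `&` iter k S @^-1` B).
  by apply: measurableI => //; exact: (measurable_iter (inverse_mp_sym TS)).
rewrite -(meas_iter TS k mC) iter_setI (iterK_preimage TS)// subnn /=.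
by rewrite setIC.
Qed.

Lemma hits_dual T S n B A : inverse_mp T S -> measurable B -> measurable A ->
  hits T n B A = hits S n A B.
Proof. by move=> TS mB mA; apply: eq_bigr => k _; exact: meas_dual. Qed.

Lemma spaced_dual T S g A : inverse_mp T S -> spaced T g A -> spaced S g A.
Proof.
move=> [_ ST _ _ _] sA j x jg Ax Ajx; apply: (sA j (iter j S x)) => //.
by rewrite (iter_cancel j ST).
Qed.

Lemma hits_ge0 T n B A : 0 <= hits T n B A.
Proof. by apply: sumr_ge0 => k _; exact: meas_ge0. Qed.

Section Pair2.
Variables T S : X -> X.
Hypothesis TS : inverse_mp T S.

Lemma le_hits n B A B' A' : fm B' -> measurable B -> measurable A ->
  measurable A' -> B `<=` B' -> A `<=` A' -> hits T n B A <= hits T n B' A'.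
Proof.
move=> fB' mB mA mA' BB AA; apply: ler_sum => k _; apply: le_meas.
- by apply: fin_measI => //; exact: (measurable_iter TS).
- by apply: measurableI => //; exact: (measurable_iter TS).
- by move=> x [/BB ? /AA].
Qed.

Lemma le_hits_n n n' B A : (n <= n')%N -> hits T n B A <= hits T n' B A.
Proof.
move=> nn; rewrite /visit_sum -!(big_mkord xpredT (fun k => m (B `&` iter k T @^-1` A))).
rewrite [leRHS](big_cat_nat _ (n := n))//= lerDl; apply: sumr_ge0 => k _; exact: meas_ge0.
Qed.

Lemma hits_splitr n B A C : fm B -> measurable A -> measurable C ->
  hits T n B A = hits T n B (A `&` C) + hits T n B (A `\` C).
Proof.
move=> fB mA mC; rewrite -big_split; apply: eq_bigr => k _ /=.
rewrite (meas_split (B := iter k T @^-1` C)); last 2 first.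
- by apply: fin_measI => //; exact: (measurable_iter TS).
- exact: (measurable_iter TS).
by congr (m _ + m _); apply/seteqP; split => x /=; tauto.
Qed.

Lemma hits_splitl n B A C : fm B -> measurable A -> measurable C ->
  hits T n B A = hits T n (B `&` C) A + hits T n (B `\` C) A.
Proof.
move=> fB mA mC; rewrite -big_split; apply: eq_bigr => k _ /=.
rewrite (meas_split (B := C))//; last first.
  by apply: fin_measI => //; exact: (measurable_iter TS).
by congr (m _ + m _); apply/seteqP; split => x /=; tauto.
Qed.

Lemma hits_cover K (Q : nat -> set X) n B A : fm B -> measurable A ->
  (forall i, (i < K)%N -> measurable (Q i)) ->
  (forall i j x, (i < j < K)%N -> Q i x -> Q j x -> False) ->
  A `<=` \bigcup_(i in `I_K) Q i ->
  hits T n B A = \sum_(i < K) hits T n B (A `&` Q i).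
Proof.
move=> fB mA mQ dQ AQ; rewrite /visit_sum exchange_big/=; apply: eq_bigr => k _.
rewrite -(sum_meas_cover (F := fun i => iter k T @^-1` Q i) (n := K)).
- by apply: eq_bigr => i _; rewrite iter_setI setIA.
- by apply: fin_measI => //; exact: (measurable_iter TS).
- by move=> i iK; apply: (measurable_iter TS); exact: mQ.
- by move=> i j x ij; exact: dQ.
- by move=> x [_ /AQ].
Qed.

(** During [g] consecutive times the preimages of [A] are pairwise disjoint, so each block of [g]
    times contributes at most [m B]. *)
Lemma hits_spaced g n B A : fm B -> measurable A -> (0 < g)%N ->
  spaced T g A -> hits T n B A <= (n %/ g).+1%:R * m B.
Proof.
move=> fB mA g0 sA.
apply: (le_trans (le_hits_n B A (ltnW (ltn_ceil n g0)))).
elim: (n %/ g).+1 => [|q ih]; first by rewrite mul0n /visit_sum big_ord0 mul0r.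
rewrite /visit_sum -(big_mkord xpredT (fun k => m (B `&` iter k T @^-1` A))).
rewrite [leLHS](big_cat_nat _ (n := (q * g)%N))//=; last by rewrite leq_mul2r leqnSn orbT.
rewrite -natr1 mulrDl mul1r lerD//; first by rewrite big_mkord.
rewrite -{1}[(q * g)%N]add0n big_addn -mulnBl subSnn mul1n big_mkord.
apply: (sum_meas_disjoint_le (F := fun i => iter (i + q * g) T @^-1` A)) => //.
  by move=> i _; exact: (measurable_iter TS).
move=> i j x /andP[ij jg] /= Ai Aj.
apply: (sA (j - i)%N (iter (i + q * g) T x)) => //.
  by rewrite subn_gt0 ij (leq_ltn_trans (leq_subr _ _)).
by rewrite -iterD addnA subnK// ltnW.
Qed.

End Pair2.

Section Pair3.
Variables T S : X -> X.
Hypothesis TS : inverse_mp T S.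

Lemma meas_iter_corr i j A : measurable A -> (i <= j)%N ->
  m (iter i T @^-1` A `&` iter j T @^-1` A) = m (A `&` iter (j - i) T @^-1` A).
Proof.
move=> mA ij; rewrite -[RHS](meas_iter TS i); last first.
  by apply: measurableI => //; exact: (measurable_iter TS).
by rewrite iter_setI iterD_preimage subnKC.
Qed.

(** Cauchy-Schwarz for the first [n] preimages of [H] inside [P]. By invariance the correlation at
    times [i] and [j] depends only on their distance, so each row of the double sum is at most twice
    [hits T n H H]. *)
Lemma hits_window n H P : fm H -> fm P ->
  (forall j, (j < n)%N -> iter j T @^-1` H `<=` P) ->
  n%:R * m H ^+ 2 <= 2 * m P * hits T n H H.
Proof.
move=> fH fP HP; have mH : measurable H by case: fH.
case: n HP => [|n] HP; first by rewrite mul0r !mulr_ge0// ?meas_ge0 ?hits_ge0.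
pose u k := m (H `&` iter k T @^-1` H).
have u0 k : 0 <= u k by exact: meas_ge0.
have := sum_meas_sqr_le fP (fun i => measurable_iter TS i mH) HP.
under eq_bigr do rewrite (meas_iter TS)//.
rewrite sumr_const card_ord -(mulr_natl (m H)) exprMn => le1.
have le2 : \sum_(i < n.+1) \sum_(j < n.+1)
    m (iter i T @^-1` H `&` iter j T @^-1` H) <= n.+1%:R * (2 * hits T n.+1 H H).
  apply: (@le_trans _ _ (\sum_(i < n.+1) (2 * hits T n.+1 H H))); last first.
    by rewrite sumr_const card_ord -(mulr_natl (2 * _)).
  apply: ler_sum => i _.
  rewrite -(big_mkord xpredT (fun j => m (iter i T @^-1` H `&` iter j T @^-1` H))).
  rewrite [leLHS](big_cat_nat _ (n := i))//=; last exact: ltnW.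
  rewrite (_ : 2 * _ = hits T n.+1 H H + hits T n.+1 H H); last by ring.
  have hE : hits T n.+1 H H = \sum_(0 <= k < n.+1) u k by rewrite big_mkord.
  apply: lerD.
    apply: (@le_trans _ _ (\sum_(0 <= k < i) u k.+1)).
      rewrite big_nat_rev/= add0n; rewrite !big_nat; apply: ler_sum => k /andP[_ ki].
      rewrite setIC meas_iter_corr//; last exact: leq_subr.
      by rewrite subKn.
    rewrite hE big_nat_recl// -[X in X <= _]add0r lerD//.
    rewrite [leRHS](big_cat_nat _ (n := i))//= ?lerDl; last by rewrite -ltnS.
    by apply: sumr_ge0.
  rewrite hE [leRHS](big_cat_nat _ (n := (n.+1 - i)%N))//=; last exact: leq_subr.
  rewrite -[X in X <= _]addr0 lerD//; last exact: sumr_ge0.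
  rewrite -{1}[nat_of_ord i]add0n big_addn !big_nat; apply: ler_sum => k _.
  by rewrite meas_iter_corr// ?leq_addl// addnK.
have n0 : (0 : R) < n.+1%:R by [].
move: (le_trans le1 (ler_wpM2l (meas_ge0 mu P) le2)) n0.
move: (m P) (hits T n.+1 H H) (m H) (n.+1%:R : R) => a b c e + e0.
rewrite (_ : a * _ = e * (2 * a * b)); last by ring.
by rewrite (_ : e ^+ 2 * _ = e * (e * c ^+ 2)) ?ler_pM2l//; ring.
Qed.

(** Three-point correlations are not reversible term by term. Pulling back by [T ^ j] turns the
    times [0, i, j] of [S] into the times [j, j - i, 0] of [T], so for a fixed largest time [j]
    reversal only permutes a row; hence an induction that adds the last row and column. *)
Lemma hits2_dual n A : measurable A -> hits2 T n A = hits2 S n A.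
Proof.
move=> mA.
pose f V i j := m (A `&` iter i V @^-1` A `&` iter j V @^-1` A).
have fC V i j : f V i j = f V j i by rewrite /f setIAC.
have step V n' : hits2 V n'.+1 A =
    hits2 V n' A + 2 * (\sum_(i < n'.+1) f V i n') - f V n' n'.
  rewrite /hits2 big_ord_recr/= -/(f V).
  under eq_bigr do rewrite big_ord_recr/=.
  rewrite big_split/= -/(f V).
  have E : \sum_(i < n') f V n' i = \sum_(i < n') f V i n'.
    by apply: eq_bigr => i _; rewrite fC.
  rewrite !big_ord_recr/= -/(f V n' n').
  rewrite [X in _ + (X + _) = _]E.
  rewrite [\sum_(i < n') m _](_ : _ = \sum_(i < n') f V i n')//.
  by ring.
have flip i j : (i <= j)%N -> f S i j = f T (j - i)%N j.
  move=> ij; have TS' := inverse_mp_sym TS.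
  have mS k := measurable_iter TS' k mA.
  rewrite /f -[LHS](meas_iter TS j); last by do !apply: measurableI.
  rewrite !iter_setI !(iterK_preimage TS)// subnn/=.
  by rewrite setIC setIA setIAC.
elim: n => [|n ih]; first by rewrite /hits2 !big_ord0.
rewrite !step ih; congr (_ + 2 * _ - _).
  rewrite (reindex_inj rev_ord_inj)/=; apply: eq_bigr => i _.
  by rewrite subSS flip// -ltnS.
by rewrite flip// subnn /f/= setIid -setIA setIid.
Qed.

(** Cauchy-Schwarz on [H], followed by enlarging the domain to [F]. It serves both to neglect a
    small part of [F] and to bound the second moment from below by a burst. *)
Lemma hits_sqr_le n F H : fm F -> measurable H -> H `<=` F ->
  hits T n H F ^+ 2 <= m H * hits2 T n F.
Proof.
move=> fF mH HF; have fH := fin_meas_sub fF mH HF; have mF : measurable F by case: fF.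
have mA i : measurable (H `&` iter i T @^-1` F).
  by apply: measurableI => //; exact: (measurable_iter TS).
have := sum_meas_sqr_le (n := n) fH mA (fun i _ => @subIsetl _ _ _).
move/le_trans; apply; apply: ler_wpM2l; first exact: meas_ge0.
apply: ler_sum => i _; apply: ler_sum => j _; apply: le_meas.
- by do 2?apply: fin_measI => //; exact: (measurable_iter TS).
- exact: measurableI.
- by move=> x [[/HF Fx Fi] [_ Fj]].
Qed.

Lemma visitsE F n x :
  visits R T F n x = (\sum_(i < n) \1_(iter i T @^-1` F) x)%:E.
Proof. by rewrite /visits big_mkord -sumEFin. Qed.

Lemma integral_visits n F : fm F ->
  (\int[mu]_(x in F) visits R T F n x = (hits T n F F)%:E)%E.
Proof.
move=> fF; under eq_integral do rewrite visitsE.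
rewrite (integral_sum_indic n (A := fun i => iter i T @^-1` F) fF)// => i.
by apply: (measurable_iter TS); case: fF.
Qed.

Lemma integral_visits_sqr n F : fm F ->
  (\int[mu]_(x in F) (visits R T F n x ^+ 2) = (hits2 T n F)%:E)%E.
Proof.
move=> fF; under eq_integral do rewrite visitsE -EFin_expe.
rewrite (integral_sum_indic_sqr n (A := fun i => iter i T @^-1` F) fF)// => i.
by apply: (measurable_iter TS); case: fF.
Qed.

Lemma rationally_ergodic_bound F : fm F -> 0 < m F ->
  (0 < limn_einf (fun n : nat =>
     (\int[mu]_(x in F) visits R T F n x) ^+ 2
     / \int[mu]_(x in F) (visits R T F n x ^+ 2)))%E ->
  exists c : R, 0 < c /\ exists N0, forall n, (N0 <= n)%N ->
    c * hits2 T n F <= hits T n F F ^+ 2.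
Proof.
move=> fF F0.
set u := fun n => _.
rewrite limn_einf_lim (cvg_lim _ (@cvg_einfs_sup R u))// => /ereal_sup_gt[_ [N _ <-]].
rewrite /einfs/= => inf0.
have [c /andP[c0 cinf]] : exists c : R, (0 < c) && (c%:E <= ereal_inf (sdrop u N))%E.
  move: inf0; case: (ereal_inf _) => [r| |]//.
    by rewrite lte_fin => r0; exists r; rewrite r0 lexx.
  by move=> _; exists 1; rewrite ltr01 leey.
(* From time 1 on the denominator is positive, since its term at times [0, 0] equals [m F], so the
   extended quotient is a genuine one. *)
exists c; split => //; exists N.+1 => -[//|n] Nn.
have cu : (c%:E <= u n.+1)%E.
  apply: (le_trans cinf); apply: ereal_inf_lbound; exists n.+1 => //=.
  exact: ltnW.
have q0 : 0 < hits2 T n.+1 F.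
  apply: lt_le_trans F0 _; rewrite /hits2 big_ord_recl big_ord_recl/= !setIid -addrA.
  rewrite lerDl addr_ge0//; do ?[apply: sumr_ge0 => ? _]; exact: meas_ge0.
move: cu; rewrite /u integral_visits// integral_visits_sqr// -EFin_expe.
by rewrite inver gt_eqF// -EFinM lee_fin ler_pdivlMr.
Qed.

End Pair3.
End MeasurePreserving.

(** * Columns and bursts *)

Lemma cbrt_ex n : exists k, (n < k.+1 ^ 3)%N.
Proof. by exists n; apply: (@leq_trans n.+1) => //; rewrite -{1}[n.+1]expn1 leq_pexp2l. Qed.

Definition cbrt n := ex_minn (cbrt_ex n).

Lemma cbrtP n : (cbrt n ^ 3 <= n < (cbrt n).+1 ^ 3)%N.
Proof.
rewrite /cbrt; case: ex_minnP => -[|k] nk kmin; first by rewrite nk.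
by rewrite nk andbT leqNgt; apply/negP => /kmin; rewrite ltnn.
Qed.

Lemma leq_cbrt k n : (k ^ 3 <= n)%N -> (k <= cbrt n)%N.
Proof.
move=> kn; rewrite -ltnS -(ltn_exp2r _ _ (e := 3))//.
by case/andP: (cbrtP n) => _; exact: leq_ltn_trans.
Qed.

(* The [N]-th column has [2 * ell N] levels, at heights [- ell N] to [ell N - 1],
   of width [1 / RR N], and is cut into [rr N] copies. With [k := cbrt N.+1],
   [pp N / qq N <= 1 / k] and [pp N ^ 2 / qq N >= k / 8]. *)
Definition qq N := N.+1.
Definition pp N := (cbrt N.+1 ^ 2)%N.
Definition rr N := (pp N * qq N)%N.

Lemma cbrt_gt0 N : (0 < cbrt N.+1)%N. Proof. exact: leq_cbrt. Qed.

Lemma pp_gt0 N : (0 < pp N)%N. Proof. by rewrite expn_gt0 cbrt_gt0. Qed.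

Lemma rr_gt0 N : (0 < rr N)%N. Proof. by rewrite muln_gt0 pp_gt0. Qed.

Lemma pp_le_rr N : (pp N <= rr N)%N. Proof. by rewrite leq_pmulr. Qed.

Lemma cbrt_pp N : (cbrt N.+1 * pp N <= qq N)%N.
Proof. by case/andP: (cbrtP N.+1) => + _; rewrite expnS. Qed.

Lemma pp_le_qq N : (pp N <= qq N)%N.
Proof. by apply: leq_trans (cbrt_pp N); rewrite leq_pmull// cbrt_gt0. Qed.

(** The factor 8 is the bound [(k + 1) ^ 3 <= 8 * k ^ 3], valid because [k >= 1]. *)
Lemma cbrt_qq N : (cbrt N.+1 * qq N <= 8 * pp N ^ 2)%N.
Proof.
case/andP: (cbrtP N.+1) => _; have := cbrt_gt0 N; rewrite /qq /pp.
by move: (cbrt _) => k k0 kN; nia.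
Qed.

(** Copy 0 stays centred at height 0. The next column extends at least [gap N] above its top copy
    and also below its bottom copy, so every orbit finally has room in both directions. *)
Fixpoint ell N : nat :=
  if N is N'.+1 then (rr N').+1 * (2 * pp N' * ell N') else 1.

(** Exactly the height of a burst, [pp N] copies of [2 * ell N] levels: a time window of this length
    can cross the burst, while it is too short for two visits to a level outside the burst. *)
Definition gap N := (2 * pp N * ell N)%N.

Lemma ellS N : ell N.+1 = ((rr N).+1 * gap N)%N. Proof. by []. Qed.

Lemma ell_gt0 N : (0 < ell N)%N.
Proof.
elim: N => // N ih; rewrite ellS /gap; have := pp_gt0 N.
by move: ih; move: (ell N) (pp N) => l p l0 p0; nia.
Qed.

Lemma gap_ge N : (2 * ell N <= gap N)%N.
Proof. by rewrite /gap; have := pp_gt0 N; move: (ell N) (pp N) => l p; nia. Qed.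

Lemma gap_gt0 N : (0 < gap N)%N.
Proof. by have := gap_ge N; have := ell_gt0 N; lia. Qed.

(* The [i]-th copy of the [N]-th column is centred at height [cpos N i] of the
   next one: the first [pp N] copies are stacked without gaps, the others are
   [gap N] apart. *)
Definition cpos N i := if (i < pp N)%N then (i * (2 * ell N))%N else (i * gap N)%N.

Lemma cpos_top N i : (i < rr N)%N -> (cpos N i + ell N + gap N <= ell N.+1)%N.
Proof.
move=> ir; rewrite /cpos ellS; have g2 := gap_ge N.
have e : (ell N <= gap N)%N by lia.
have h : (i.+1 * gap N <= rr N * gap N)%N by rewrite leq_mul2r ir orbT.
have h2 : (i * (2 * ell N) <= i * gap N)%N by rewrite leq_mul2l g2 orbT.
by rewrite mulSn; move: h; rewrite mulSn; case: ifP => _; lia.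
Qed.

Lemma cpos_sep N i j : (i < j)%N -> (cpos N i + 2 * ell N <= cpos N j)%N.
Proof.
move=> ij; rewrite /cpos; have g2 := gap_ge N.
have h : (i.+1 * gap N <= j * gap N)%N by rewrite leq_mul2r ij orbT.
have h1 : (i.+1 * (2 * ell N) <= j * (2 * ell N))%N by rewrite leq_mul2r ij orbT.
have h2 : (i * (2 * ell N) <= i * gap N)%N by rewrite leq_mul2l g2 orbT.
by move: h h1; rewrite !mulSn; do 2!case: ifP => ?; lia.
Qed.

Lemma cpos_inj N i j (f g : int) :
  - (ell N)%:Z <= f < (ell N)%:Z -> - (ell N)%:Z <= g < (ell N)%:Z ->
  (cpos N i)%:Z + f = (cpos N j)%:Z + g -> i = j /\ f = g.
Proof.
move=> fr gr E; have [ij|ji|ij] := ltngtP i j.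
- by have := cpos_sep N ij; lia.
- by have := cpos_sep N ji; lia.
- by split => //; move: E; rewrite ij => /addrI.
Qed.

Definition RR N := (\prod_(i < N) rr i)%N.

Lemma RRS N : RR N.+1 = (RR N * rr N)%N. Proof. exact: big_ord_recr. Qed.

Lemma RR_gt0 N : (0 < RR N)%N.
Proof. by elim: N => [|N ih]; [rewrite /RR big_ord0|rewrite RRS muln_gt0 ih rr_gt0]. Qed.

(** * Levels, bursts and return times in an abstract tower *)

Section Tower.
Context d (X : measurableType d) (R : realType) (mu : {measure set X -> \bar R}).
Local Notation m := (meas mu).
Local Notation fm := (fin_meas mu).
Variables (T S : X -> X) (pos : nat -> X -> int).

Definition inside N (f : int) := - (ell N)%:Z <= f < (ell N)%:Z.

Definition lev N f := pos N @^-1` [set f].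

Definition lset N (P : set int) := [set x | inside N (pos N x) /\ P (pos N x)].

Definition column N := lset N setT.

Definition width N : R := (RR N)%:R^-1.

Local Notation ww := width.

(* [pos N x] is the height of [x] in the [N]-th column when [inside N (pos N x)].
   It is a junk value otherwise, but every level, inside or not, has the same
   width. *)
Record tower : Prop := Tower {
  tow_mp : inverse_mp mu T S;
  tow_lev : forall N f, measurable (lev N f) /\ mu (lev N f) = (ww N)%:E;
  tow_step : forall N f x, inside N f ->
    pos N x = f <-> exists2 i, (i < rr N)%N & pos N.+1 x = (cpos N i)%:Z + f;
  tow_T : forall N x, inside N (pos N x) -> inside N (pos N x + 1) ->
    pos N (T x) = pos N x + 1;
  tow_S : forall N x, inside N (pos N x) -> inside N (pos N x - 1) ->
    pos N (S x) = pos N x - 1;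
  tow_cover : forall x, exists N, inside N (pos N x);
  tow_approx : forall A (e : R), fm A -> 0 < e -> exists N P,
    m (A `\` lset N P) + m (lset N P `\` A) < e }.

Hypothesis tow : tower.

Let TS : inverse_mp mu T S := tow_mp tow.

Lemma width_gt0 N : 0 < ww N.
Proof. by rewrite invr_gt0 ltr0n RR_gt0. Qed.

Lemma widthS N : ww N = (rr N)%:R * ww N.+1.
Proof.
rewrite /width RRS natrM invfM mulrCA divff ?mulr1// pnatr_eq0 -lt0n.
exact: rr_gt0.
Qed.

Lemma fin_meas_lev N f : fm (lev N f).
Proof. by case: (tow_lev tow N f) => ? E; split; rewrite ?E ?ltry. Qed.

Lemma meas_lev N f : m (lev N f) = ww N.
Proof. by case: (tow_lev tow N f) => ? E; rewrite /meas E. Qed.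

Lemma pos_iterT N x k : inside N (pos N x) -> inside N (pos N x + k%:Z) ->
  pos N (iter k T x) = pos N x + k%:Z.
Proof.
rewrite /inside => hx; elim: k => [|k ih] hk; first by rewrite addr0.
rewrite iterS (tow_T tow) ih /inside; lia.
Qed.

Lemma pos_iterS N x k : inside N (pos N x) -> inside N (pos N x - k%:Z) ->
  pos N (iter k S x) = pos N x - k%:Z.
Proof.
rewrite /inside => hx; elim: k => [|k ih] hk; first by rewrite subr0.
rewrite iterS (tow_S tow) ih /inside; lia.
Qed.

Definition nth_level N (i : nat) := lev N (i%:Z - (ell N)%:Z).

Lemma col_levi N : column N `<=` \bigcup_(i in `I_(2 * ell N)) nth_level N i.
Proof.
move=> x [+ _]; rewrite /inside => xr; exists (absz (pos N x + (ell N)%:Z)) => /=; first lia.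
by rewrite /nth_level /lev /=; lia.
Qed.

Lemma levi_disj N i j x : (i < j)%N -> nth_level N i x -> nth_level N j x -> False.
Proof. by rewrite /nth_level /lev /= => ij -> ; lia. Qed.

Lemma levi_inside N i x : (i < 2 * ell N)%N -> nth_level N i x -> inside N (pos N x).
Proof. by rewrite /nth_level /lev /inside /=; lia. Qed.

Lemma sub_lset_col N P : lset N P `<=` column N. Proof. by move=> x []. Qed.

Lemma lset_setU N P : lset N P = \bigcup_(i in `I_(2 * ell N) `&` [set i | P (i%:Z - (ell N)%:Z)]) nth_level N i.
Proof.
apply/seteqP; split => x.
  move=> xP; have [i /= iK xi] := col_levi (sub_lset_col xP).
  by exists i => //; split => //=; move: xP; rewrite /lset /= xi => -[].
by move=> [i [/= iK Pi] xi]; split; [exact: levi_inside xi|rewrite xi].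
Qed.

Lemma fin_meas_lset N P : fm (lset N P).
Proof.
apply: (@fin_meas_sub _ _ _ _ _ (\bigcup_(i in `I_(2 * ell N)) nth_level N i)).
- by apply: fin_meas_bigcup => i _; exact: fin_meas_lev.
- rewrite lset_setU; apply: bigcup_measurable => i _.
  by case: (fin_meas_lev N (i%:Z - (ell N)%:Z)).
- by move=> x /sub_lset_col /col_levi.
Qed.

Lemma fin_meas_col N : fm (column N). Proof. exact: fin_meas_lset. Qed.

Lemma meas_levels N B : fm B -> B `<=` column N ->
  m B = \sum_(i < 2 * ell N) m (B `&` nth_level N i).
Proof.
move=> fB BN; rewrite (sum_meas_cover (F := nth_level N))//.
- by move=> i _; case: (fin_meas_lev N (i%:Z - (ell N)%:Z)).
- by move=> i j x /andP[ij _]; exact: levi_disj.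
- by move=> x /BN /col_levi.
Qed.

Definition level_union N Q := exists P, Q = lset N P.

Lemma isL_levi N Q i : level_union N Q -> (i < 2 * ell N)%N ->
  Q `&` nth_level N i = nth_level N i \/ Q `&` nth_level N i = set0.
Proof.
move=> [P ->] iN; have [Pi|nPi] := pselect (P (i%:Z - (ell N)%:Z)); [left|right].
  apply/seteqP; split => x; first by case.
  by move=> xi; split => //; split; [exact: levi_inside xi|rewrite xi].
by apply/seteqP; split => x // [[_ +] xi]; rewrite xi.
Qed.

Lemma isL_fm N Q : level_union N Q -> fm Q. Proof. by move=> [P ->]; exact: fin_meas_lset. Qed.

Lemma isL_col N Q : level_union N Q -> Q `<=` column N.
Proof. by move=> [P ->]; exact: sub_lset_col. Qed.

Lemma isL_setI N Q Q' : level_union N Q -> level_union N Q' -> level_union N (Q `&` Q').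
Proof.
move=> [P ->] [P' ->]; exists (P `&` P').
by apply/seteqP; split => x /=; rewrite /lset /=; tauto.
Qed.

Lemma isL_setD N Q Q' : level_union N Q -> level_union N Q' -> level_union N (Q `\` Q').
Proof.
move=> [P ->] [P' ->]; exists (P `\` P').
by apply/seteqP; split => x /=; rewrite /lset /=; tauto.
Qed.

Lemma inside_cpos N i f : inside N f -> (i < rr N)%N -> inside N.+1 ((cpos N i)%:Z + f).
Proof. by rewrite /inside => fr ir; have := cpos_top ir; have := gap_gt0 N; lia. Qed.

Lemma isL_step N Q : level_union N Q -> level_union N.+1 Q.
Proof.
move=> [P ->]; exists [set g | exists i f,
  [/\ (i < rr N)%N, inside N f, P f & g = (cpos N i)%:Z + f]].
apply/seteqP; split => x.
  move=> [xr Px]; have [/(_ erefl)[i ir E] _] := tow_step tow x xr.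
  split; first by rewrite E; exact: inside_cpos.
  by exists i, (pos N x); split.
move=> [xr [i [f [ir fr Pf E]]]]; have xf : pos N x = f.
  by apply/(tow_step tow _ fr); exists i.
by split; rewrite xf.
Qed.

Lemma isL_le N N' Q : (N <= N')%N -> level_union N Q -> level_union N' Q.
Proof.
move=> NN' LQ; rewrite -(subnK NN') addnC; elim: (N' - N)%N => [|k ih].
  by rewrite addn0.
by rewrite addnS; exact: isL_step.
Qed.

Lemma isL_colN N : level_union N (column N). Proof. by exists setT. Qed.

Lemma sub_col N N' : (N <= N')%N -> column N `<=` column N'.
Proof. by move=> NN'; exact/isL_col/(isL_le NN')/isL_colN. Qed.

(* The union of the first [pp N] copies of the [N]-th column. *)
Definition burst N :=
  lset N.+1 [set g | - (ell N)%:Z <= g < (2 * pp N)%:Z * (ell N)%:Z - (ell N)%:Z].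

Lemma isL_burst N : level_union N.+1 (burst N). Proof. by eexists. Qed.

Lemma burstP N f x : inside N f ->
  (burst N x /\ pos N x = f) <->
  exists2 i, (i < pp N)%N & pos N.+1 x = (cpos N i)%:Z + f.
Proof.
move=> fr; split.
  move=> [[_ /= cx] xf]; have [/(_ xf)[i ir E] _] := tow_step tow x fr.
  exists i => //; rewrite ltnNge; apply/negP => pi.
  move: cx; rewrite E /cpos ltnNge pi /=.
  have h : (pp N * (2 * ell N) <= i * gap N)%N by apply: leq_mul => //; exact: gap_ge.
  by move: fr; rewrite /inside; lia.
move=> [i ip E]; have ir := leq_trans ip (pp_le_rr N).
split; last by apply/(tow_step tow _ fr); exists i.
split; rewrite E; first exact: inside_cpos.
rewrite /= /cpos ip; move: fr; rewrite /inside.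
have h : (i.+1 * (2 * ell N) <= pp N * (2 * ell N))%N by rewrite leq_mul2r ip orbT.
by move: h; rewrite mulSn; lia.
Qed.

(** The burst contains [pp N] of the [pp N * qq N] equal parts of each level. *)
Lemma meas_levi_burst N i : (i < 2 * ell N)%N ->
  m (nth_level N i `&` burst N) = (qq N)%:R^-1 * ww N.
Proof.
move=> iN; set f := i%:Z - (ell N)%:Z.
have fr : inside N f by rewrite /inside /f; lia.
have -> : nth_level N i `&` burst N =
    \bigcup_(j in `I_(pp N)) lev N.+1 ((cpos N j)%:Z + f).
  apply/seteqP; split => x.
    by move=> [xf xc]; have [/(_ (conj xc xf))[j jp E] _] := burstP x fr; exists j.
  by move=> [j jp E]; have [_ /(_ (ex_intro2 _ _ j jp E))[]] := burstP x fr.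
have fU : fm (\bigcup_(j in `I_(pp N)) lev N.+1 ((cpos N j)%:Z + f)).
  by apply: fin_meas_bigcup => j _; exact: fin_meas_lev.
rewrite -(sum_meas_cover (n := pp N)
  (F := fun j => lev N.+1 ((cpos N j)%:Z + f)) fU)//; last 2 first.
- by move=> j _; case: (fin_meas_lev N.+1 ((cpos N j)%:Z + f)).
- move=> j k x /andP[jk _]; rewrite /lev /= => -> /(cpos_inj fr fr)[jk' _].
  by rewrite jk' ltnn in jk.
rewrite (eq_bigr (fun _ => ww N.+1)); last first.
  move=> j _; rewrite setIidr ?meas_lev// => x xj; exists j => //=.
rewrite sumr_const card_ord (widthS N) /rr natrM -[LHS]mulr_natl.
have q0 : (qq N)%:R != 0 :> R by rewrite pnatr_eq0.
by field.
Qed.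

(** This is the independence of the bursts: earlier bursts, and everything built from them inside a
    column, are unions of levels of the [N]-th column. *)
Lemma meas_isL_burst N Q : level_union N Q -> m (Q `&` burst N) = (qq N)%:R^-1 * m Q.
Proof.
move=> LQ; have fQ := isL_fm LQ; have QN := isL_col LQ.
have [mc _] : fm (burst N) by exact: fin_meas_lset.
rewrite (meas_levels fQ QN) mulr_sumr (meas_levels (B := Q `&` burst N) (N := N)).
- apply: eq_bigr => i _; rewrite setIAC.
  case: (isL_levi LQ (ltn_ord i)) => ->; last by rewrite set0I !meas0 mulr0.
  by rewrite meas_levi_burst// meas_lev.
- exact: fin_measI.
- by move=> x [/QN].
Qed.

(** Half the height of the column is enough and is easy to control: from the lower half the orbit is
    followed upwards, and for the upper half it is followed downwards from the return point. *)
Lemma levi_sep N i : (i < 2 * ell N)%N -> spaced T (ell N) (nth_level N i).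
Proof.
move=> iN j x /andP[j0 je]; rewrite /nth_level /lev /= => xi yi.
have [TK _ _ _ _] := TS.
have [iL|iL] := ltnP i (ell N).
  have := @pos_iterT N x j; rewrite xi yi /inside; lia.
have := @pos_iterS N (iter j T x) j; rewrite (iter_cancel j TK) xi yi /inside; lia.
Qed.

(** Outside the burst a level of the [N]-th column reappears in the next one at heights that differ
    by multiples of [gap N]. The room left above the top copy keeps the orbit inside the next column
    for [gap N] steps, so the heights can be compared. *)
Lemma levi_sep_burst N i : (i < 2 * ell N)%N ->
  spaced T (gap N) (nth_level N i `\` burst N).
Proof.
move=> iN j x /andP[j0 jg]; set f := i%:Z - (ell N)%:Z => -[xi xc] [yi yc].
have fr : inside N f by rewrite /inside /f; lia.
have sp z : pos N z = f -> ~ burst N z ->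
    exists2 k, (pp N <= k < rr N)%N & pos N.+1 z = (k * gap N)%N%:Z + f.
  move=> zf zc; have [/(_ zf)[k kr E] _] := tow_step tow z fr; exists k.
    rewrite kr andbT leqNgt; apply/negP => kp; apply: zc.
    by have [_ /(_ (ex_intro2 _ _ k kp E))[]] := burstP z fr.
  rewrite E /cpos; case: ifP => // kp; exfalso; apply: zc.
  by have [_ /(_ (ex_intro2 _ _ k kp E))[]] := burstP z fr.
have [k /andP[kp kr] Ek] := sp _ xi xc; have [l /andP[lp lr] El] := sp _ yi yc.
have ktop : (k * gap N + ell N + gap N <= ell N.+1)%N.
  by have := cpos_top kr; rewrite /cpos ltnNge kp.
have xr : inside N.+1 (pos N.+1 x) by rewrite Ek; move: fr; rewrite /inside; lia.
have := @pos_iterT N.+1 x j xr; rewrite El Ek => E.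
have {}E : (l * gap N)%N%:Z + f = (k * gap N)%N%:Z + f + j%:Z.
  by apply: E; move: fr; rewrite /inside; lia.
have {}E : (l * gap N = k * gap N + j)%N by lia.
have kl : (k < l)%N by rewrite -(ltn_pmul2r (gap_gt0 N)) E; lia.
have : (k.+1 * gap N <= l * gap N)%N by rewrite leq_mul2r kl orbT.
by rewrite mulSn; lia.
Qed.

End Tower.

(** * Bounds on visit counts *)

Section Bounds.
Context d (X : measurableType d) (R : realType) (mu : {measure set X -> \bar R}).
Local Notation m := (meas mu).
Local Notation fm := (fin_meas mu).
Variables (T S : X -> X) (pos : nat -> X -> int).
Hypothesis tow : tower mu T S pos.

Local Notation isL := (level_union pos).
Local Notation levi := (nth_level pos).
Local Notation burst := (burst pos).
Local Notation col := (column pos).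
Local Notation hits := (visit_sum mu).
Local Notation ww := (width R).
Let TS : inverse_mp mu T S := tow_mp tow.

(** The factor [RR N * m Q] is the number of levels in [Q], and each of them is treated by
    [hits_spaced]. The transformation is a variable because the reversed bound uses [S]. *)
Lemma hits_packed V W g N Q D n B : inverse_mp mu V W -> (0 < g)%N -> isL N Q ->
  measurable D -> (forall i, (i < 2 * ell N)%N -> spaced V g (levi N i `&` D)) ->
  fm B -> hits V n B (Q `&` D) <= (RR N)%:R * m Q * (n %/ g).+1%:R * m B.
Proof.
move=> VW g0 LQ mD sD fB; have [mQ _] := isL_fm tow LQ; have QN := isL_col LQ.
have mlev i : measurable (levi N i).
  by case: (fin_meas_lev tow N (i%:Z - (ell N)%:Z)).
rewrite (hits_cover VW n (K := (2 * ell N)%N) (Q := levi N) fB); first last.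
- by move=> x [/QN /col_levi].
- by move=> i j x /andP[ij _]; exact: levi_disj.
- by [].
- exact: measurableI.
rewrite (meas_levels tow (isL_fm tow LQ) QN) mulr_sumr !mulr_suml.
apply: ler_sum => i _; rewrite setIAC.
case: (isL_levi LQ (ltn_ord i)) => ->.
  rewrite (meas_lev tow) divff ?mul1r; last by rewrite pnatr_eq0 -lt0n RR_gt0.
  by apply: (hits_spaced VW) => //; [exact: measurableI|exact: sD].
rewrite set0I meas0 mulr0 !mul0r /visit_sum big1// => k _.
by rewrite preimage_set0 setI0 meas0.
Qed.

Lemma hits_packedl g N Q D n B : (0 < g)%N -> isL N Q ->
  measurable D -> (forall i, (i < 2 * ell N)%N -> spaced T g (levi N i `&` D)) ->
  fm B -> hits T n (Q `&` D) B <= (RR N)%:R * m Q * (n %/ g).+1%:R * m B.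
Proof.
move=> g0 LQ mD sD fB; have [mQ _] := isL_fm tow LQ.
rewrite (hits_dual n TS); [|exact: measurableI|by case: fB].
apply: (hits_packed n (inverse_mp_sym TS)) => // i iN.
by apply: (spaced_dual TS); exact: sD.
Qed.

Lemma measurable_burst N : measurable (burst N).
Proof. by case: (fin_meas_lset tow N.+1 _ : fm (burst N)). Qed.

Lemma hits_isL N Q n B : isL N Q -> fm B ->
  hits T n B Q <= (RR N)%:R * m Q * (n %/ ell N).+1%:R * m B /\
  hits T n Q B <= (RR N)%:R * m Q * (n %/ ell N).+1%:R * m B.
Proof.
move=> LQ fB.
have sp i : (i < 2 * ell N)%N -> spaced T (ell N) (levi N i `&` setT).
  by rewrite setIT; exact: (levi_sep tow).
have := hits_packed n TS (ell_gt0 N) LQ measurableT sp fB.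
by have := hits_packedl n (ell_gt0 N) LQ measurableT sp fB; rewrite setIT.
Qed.

Lemma hits_sparse N Q n B : isL N Q -> fm B ->
  hits T n B (Q `\` burst N) <= (RR N)%:R * m Q * (n %/ gap N).+1%:R * m B /\
  hits T n (Q `\` burst N) B <= (RR N)%:R * m Q * (n %/ gap N).+1%:R * m B.
Proof.
move=> LQ fB; rewrite setDE.
have mC : measurable (~` burst N) by apply: measurableC; exact: measurable_burst.
have sp i : (i < 2 * ell N)%N -> spaced T (gap N) (levi N i `&` ~` burst N).
  by rewrite -setDE; exact: (levi_sep_burst tow).
split; first by apply: (hits_packed n TS) => //; exact: gap_gt0.
by apply: hits_packedl => //; exact: gap_gt0.
Qed.

(** Inside the burst, [Q] is a union of levels of the next column,
    [RR N.+1 * m Q / qq N = RR N * pp N * m Q] in number, with returns at least [ell N.+1] apart. *)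
Lemma hits_burst N Q n B : isL N Q -> fm B ->
  hits T n B (Q `&` burst N) <=
    (RR N)%:R * (pp N)%:R * m Q * (n %/ ell N.+1).+1%:R * m B /\
  hits T n (Q `&` burst N) B <=
    (RR N)%:R * (pp N)%:R * m Q * (n %/ ell N.+1).+1%:R * m B.
Proof.
move=> LQ fB.
have LC : isL N.+1 (Q `&` burst N).
  by apply: isL_setI; [exact: (isL_step tow)|exact: isL_burst].
have := hits_isL n LC fB; rewrite (meas_isL_burst tow LQ) RRS (natrM _ (RR N)) (natrM _ (pp N)).
have q0 : (qq N)%:R != 0 :> R by rewrite pnatr_eq0.
rewrite (_ : (RR N)%:R * _ * _ = (RR N)%:R * (pp N)%:R * m Q)//.
by field.
Qed.

(** The other set is split by the burst as well. The factor [1 / qq N] is the share of [F] in the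
    burst, and it compensates the [pp N] of the visits from burst to burst. *)
Lemma hits_burst_small N F n : isL N F ->
  let bound := (qq N)%:R^-1 * m F ^+ 2 * (RR N)%:R *
      ((n %/ gap N).+1%:R + (pp N)%:R * (n %/ ell N.+1).+1%:R) in
  hits T n F (F `&` burst N) <= bound /\ hits T n (F `&` burst N) F <= bound.
Proof.
move=> LF; have fF := isL_fm tow LF; have mC := measurable_burst N.
have fC : fm (F `&` burst N) by exact: fin_measI.
have [mF _] := fF; have [mFC _] := fC.
have [s1 s2] := hits_sparse n LF fC; have [c1 c2] := hits_burst n LF fC.
rewrite (meas_isL_burst tow LF) in s1 s2 c1 c2.
split.
  rewrite (hits_splitl TS n _ _ mC)// addrC; apply: (le_trans (lerD s2 c2)).
  by rewrite le_eqVlt; apply/orP; left; apply/eqP; ring.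
rewrite (hits_splitr TS n _ _ mC)// addrC; apply: (le_trans (lerD s1 c1)).
by rewrite le_eqVlt; apply/orP; left; apply/eqP; ring.
Qed.

(** The source of uniform integrability: off the burst the visits are proportional to [m Q], and the
    burst contributes a term in which [pp N] is divided by [qq N]. *)
Lemma hits_sub N F Q n : isL N F -> measurable Q -> Q `<=` F ->
  let bound := (RR N)%:R * m F * (n %/ gap N).+1%:R * m Q +
    (qq N)%:R^-1 * m F ^+ 2 * (RR N)%:R *
      ((n %/ gap N).+1%:R + (pp N)%:R * (n %/ ell N.+1).+1%:R) in
  hits T n Q F <= bound /\ hits T n F Q <= bound.
Proof.
move=> LF mQ QF; have fF := isL_fm tow LF; have mC := measurable_burst N.
have [mF _] := fF; have fQ := fin_meas_sub fF mQ QF.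
have [s1 s2] := hits_sparse n LF fQ; have [c1 c2] := hits_burst_small n LF.
have mFC : measurable (F `&` burst N) by exact: measurableI.
have mQC : measurable (Q `&` burst N) by exact: measurableI.
have fFC : fm (F `&` burst N) by exact: fin_measI.
have QFC : Q `&` burst N `<=` F `&` burst N by exact: setSI.
split.
  rewrite (hits_splitr TS n _ _ mC)// addrC; apply: (lerD s1).
  by apply: le_trans c1; apply: (le_hits TS).
rewrite (hits_splitl TS n _ _ mC)// addrC; apply: (lerD s2).
by apply: le_trans c2; apply: (le_hits TS).
Qed.

(* A run of [K] consecutive levels is visited before time [n] only from itself
   or from the [n] preimages of its bottom level. *)
Lemma hits_run M (a : int) K H n : fm H -> - (ell M)%:Z <= a ->
  a + K%:Z <= (ell M)%:Z -> H `<=` lset pos M [set g | a <= g < a + K%:Z] ->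
  n%:R * m H ^+ 2 <= 2 * ((K + n)%:R * ww M) * hits T n H H.
Proof.
move=> fH aM KM HY; have [TK _ _ _ _] := TS.
pose P1 := \bigcup_(i in `I_K) lev pos M (a + i%:Z).
pose P2 := \bigcup_(i in `I_n) (iter i T @^-1` lev pos M a).
have fP1 : fm P1 by apply: fin_meas_bigcup => i _; exact: (fin_meas_lev tow).
have fP2 : fm P2.
  by apply: fin_meas_bigcup => i _; apply: (fin_meas_iter TS); exact: (fin_meas_lev tow).
have mP : m (P1 `|` P2) <= (K + n)%:R * ww M.
  apply: (le_trans (measU_le fP1 fP2)); rewrite natrD mulrDl; apply: lerD.
    apply: le_trans (meas_bigcup_le _) _ => [i _|]; first exact: (fin_meas_lev tow).
    under eq_bigr do rewrite (meas_lev tow).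
    by rewrite sumr_const card_ord mulr_natl.
  apply: le_trans (meas_bigcup_le _) _ => [i _|].
    by apply: (fin_meas_iter TS); exact: (fin_meas_lev tow).
  have [ma _] := fin_meas_lev tow M a.
  under eq_bigr do rewrite (meas_iter TS _ ma) (meas_lev tow).
  by rewrite sumr_const card_ord mulr_natl.
apply: le_trans (hits_window TS fH (fin_measU fP1 fP2) _) _; last first.
  apply: ler_wpM2r; first exact: hits_ge0.
  by apply: ler_wpM2l.
move=> j jn x /= /HY[yr /= /andP[ay yK]].
set y := iter j T x in yr ay yK.
have [ja|ja] := lerP (j%:Z) (pos M y - a).
  left; exists (absz (pos M y - j%:Z - a)%R) => /=; first lia.
  have := @pos_iterS _ _ _ _ _ _ _ tow M y j yr.
  rewrite /y (iter_cancel j TK) -/y /lev /= => ->; last by rewrite /inside; lia.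
  lia.
right; pose i := absz (pos M y - a).
have ij : (i < j)%N by rewrite /i; lia.
exists (j - i)%N => /=; first by lia.
have xE : iter (j - i) T x = iter i S y.
  by rewrite /y -{2}(subnKC (ltnW ij)) iterD (iter_cancel i TK).
rewrite /lev /= xE (pos_iterS tow) ?/inside//; rewrite /i; lia.
Qed.

End Bounds.

(** * Ratio limits *)

Lemma ell_mono N N' : (N <= N')%N -> (ell N <= ell N')%N.
Proof.
move=> NN'; rewrite -(subnK NN') addnC; elim: (N' - N)%N => [|k ih].
  by rewrite addn0.
rewrite addnS; apply: (leq_trans ih); rewrite ellS mulSn.
by have := gap_ge (N + k); lia.
Qed.

Lemma ell_ge N : (N < ell N)%N.
Proof.
elim: N => // N ih; rewrite ellS mulSn; have := gap_ge N; lia.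
Qed.

Lemma gap_gt N : (N < gap N)%N.
Proof. by have := ell_ge N; have := gap_ge N; lia. Qed.

Lemma scale_ex n : (2 <= n)%N ->
  exists N, (2 * ell N <= n < 2 * ell N.+1)%N.
Proof.
move=> n2; have ex : exists N, (n < 2 * ell N.+1)%N.
  by exists n; have := ell_ge n.+1; lia.
case: (ex_minnP ex) => -[|N] nN Nmin; [exists 0%N|exists N.+1].
  by rewrite nN andbT.
by rewrite nN andbT leqNgt; apply/negP => /Nmin; rewrite ltnn.
Qed.

Lemma scale_ge N N' n : (2 * ell N' <= n)%N -> (n < 2 * ell N.+1)%N -> (N' <= N)%N.
Proof.
move=> h1 h2; rewrite leqNgt; apply/negP => NN'.
by have := ell_mono NN'; lia.
Qed.

Lemma RR_ge N : (N <= RR N)%N.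
Proof.
elim: N => // N ih; rewrite RRS.
have : (N.+1 <= rr N)%N by rewrite /rr /qq leq_pmull// pp_gt0.
by have := RR_gt0 N; move: (RR N) (rr N) => a b; nia.
Qed.

Section WeakRatio.
Context d (X : measurableType d) (R : realType) (mu : {measure set X -> \bar R}).
Local Notation m := (meas mu).
Local Notation fm := (fin_meas mu).
Variables (T S : X -> X) (pos : nat -> X -> int).
Hypothesis tow : tower mu T S pos.

Local Notation isL := (level_union pos).
Local Notation levi := (nth_level pos).
Local Notation burst := (burst pos).
Local Notation col := (column pos).
Local Notation hits := (visit_sum mu).
Local Notation ww := (width R).
Let TS : inverse_mp mu T S := tow_mp tow.
Let F := col 0%N.
Local Notation a n := (hits T n F F).

Lemma meas_col N : m (col N) = (2 * ell N)%:R * ww N.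
Proof.
rewrite (meas_levels tow (fin_meas_col tow N) (fun _ h => h)).
rewrite (eq_bigr (fun _ => ww N)); first by rewrite sumr_const card_ord mulr_natl.
move=> i _; rewrite setIidr ?(meas_lev tow)// => x xi.
by split => //; exact: levi_inside xi.
Qed.

Lemma meas_col0 : m F = 2.
Proof. by rewrite meas_col /width /RR big_ord0 invr1 mulr1. Qed.

Lemma hits_run_col M n : (2 * n * RR M)%:R <= (2 * ell M + n)%:R * a n.
Proof.
have LF : isL M F by apply: (isL_le tow (leq0n M)); exact: isL_colN.
have := @hits_run _ _ _ _ _ _ _ tow M (- (ell M)%:Z) (2 * ell M)%N F n
  (fin_meas_col tow 0) (lexx _).
have -> : - (ell M)%:Z + (2 * ell M)%N%:Z = (ell M)%:Z by lia.
move=> /(_ (lexx _)); rewrite meas_col0.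
have FY : F `<=` lset pos M [set g | - (ell M)%:Z <= g < (ell M)%:Z].
  by move=> x Fx; have [h _] := isL_col LF Fx; split.
move=> /(_ FY); have R0 : (0 : R) < (RR M)%:R by rewrite ltr0n RR_gt0.
rewrite -(ler_pM2r R0) /width !natrM => h.
have E : 2 * ((2 * ell M + n)%:R / (RR M)%:R) * a n * (RR M)%:R =
         2 * ((2 * ell M + n)%:R * a n) by field; rewrite gt_eqF.
by move: h; rewrite E; move: (_ * a n) => z; nra.
Qed.

(** Two uses of [hits_run_col]: the [N]-th column gives [RR N <= a n], the next one gives
    [n * RR N <= 4 * gap N * a n]. The constant is [5 = 1 + 4]. *)
Lemma hits_col0_ge N n : (2 * ell N <= n < 2 * ell N.+1)%N ->
  (RR N)%:R <= a n /\ (RR N)%:R * (n %/ gap N).+1%:R <= 5 * a n.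
Proof.
move=> /andP[n1 n2]; have a0 : 0 <= a n by exact: hits_ge0.
have n0 : (0 < n)%N by have := ell_gt0 N; lia.
have e0 := ell_gt0 N.
have h1 : (RR N)%:R <= a n.
  have h := hits_run_col N n.
  have nR : (0 : R) < (2 * n)%:R by rewrite ltr0n; lia.
  rewrite -(ler_pM2l nR) -natrM; apply: (le_trans h).
  by apply: ler_wpM2r => //; rewrite ler_nat; lia.
split => //.
have h2 : (n * RR N)%:R <= 4 * (gap N)%:R * a n.
  have := hits_run_col N.+1 n; rewrite RRS ellS => h.
  have rR : (0 : R) < (2 * rr N)%:R by rewrite ltr0n muln_gt0 rr_gt0.
  rewrite -(ler_pM2l rR).
  have -> : (2 * rr N)%:R * (n * RR N)%:R = (2 * n * (RR N * rr N))%:R :> R.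
    by rewrite -natrM; congr _%:R; ring.
  apply: (le_trans h); rewrite mulrA; apply: ler_wpM2r => //.
  rewrite -!natrM ler_nat; rewrite ellS in n2.
  have r0 := rr_gt0 N; have g0 := gap_gt0 N.
  move: n2; move: (rr N) (gap N) r0 g0 => r g r0 g0 n2; nia.
have g0 : (0 : R) < (gap N)%:R by rewrite ltr0n gap_gt0.
rewrite -natr1 mulrDr mulr1.
suff : (RR N)%:R * (n %/ gap N)%:R <= 4 * a n by move: h1; lra.
rewrite -(ler_pM2l g0).
have h3 : (gap N)%:R * ((RR N)%:R * (n %/ gap N)%:R) <= (n * RR N)%:R :> R.
  rewrite -!natrM ler_nat; have := leq_trunc_div n (gap N).
  by move: (n %/ gap N)%N (gap N) (RR N) => x y z; nia.
by apply: (le_trans (le_trans h3 h2)); rewrite mulrA [_ * 4]mulrC.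
Qed.

Lemma hits_sub_small (e : R) : 0 < e -> exists n0, forall n, (n0 <= n)%N ->
  forall Q, measurable Q -> Q `<=` F ->
  hits T n Q F <= (10 * m Q + e) * a n /\ hits T n F Q <= (10 * m Q + e) * a n.
Proof.
(* [60 = 4 * 15]: the [4] is [m F ^ 2], and [15 = 3 * 5] comes from [G + p * l <= 3 * p * G] and
   [hits_col0_ge]. Beyond [K ^ 3] the ratio [pp / qq] is at most [1 / K]. The factor 10 of the
   statement is [5 * m F]. *)
move=> e0; pose K := (Num.truncn (60 / e)).+1.
have Ke : 60 <= K%:R * e.
  by rewrite -ler_pdivrMr// ltW// /K truncnS_gt.
exists (2 * ell (K ^ 3))%N => n nn Q mQ QF.
have [N /andP[n1 n2]] : exists N, (2 * ell N <= n < 2 * ell N.+1)%N.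
  by apply: scale_ex; apply: leq_trans nn; have := ell_gt0 (K ^ 3); lia.
have KN : (K <= cbrt N.+1)%N by apply/leq_cbrt/leqW; exact: scale_ge nn n2.
have LF : isL N F by apply: (isL_le tow (leq0n N)); exact: isL_colN.
have := hits_sub tow n LF mQ QF; rewrite meas_col0 /=.
have [_ aN] := hits_col0_ge (introT andP (conj n1 n2)).
have a0 : 0 <= a n by exact: hits_ge0.
set b := _ + _.
suff bb : b <= (10 * m Q + e) * a n.
  by move=> [h1 h2]; split; [apply: le_trans h1 bb|apply: le_trans h2 bb].
rewrite /b mulrDl; apply: lerD.
  have := ler_wpM2r (meas_ge0 mu Q) aN.
  by move: (m Q) (a n) (RR N)%:R (_.+1%:R) => x y z t; lra.
have nl : (n %/ ell N.+1 < 2)%N by rewrite ltn_divLR ?ell_gt0.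
have p1 : (1 : R) <= (pp N)%:R by rewrite ler1n pp_gt0.
have Kp : K%:R * (pp N)%:R <= (qq N)%:R :> R.
  rewrite -natrM ler_nat; apply: leq_trans (cbrt_pp N).
  by rewrite leq_mul2r KN orbT.
have q0 : (0 : R) < (qq N)%:R by rewrite ltr0n.
have G1 : (1 : R) <= (n %/ gap N).+1%:R by rewrite ler1n.
have l2 : ((n %/ ell N.+1).+1%:R : R) <= 2 by rewrite ler_nat.
have l0 : (0 : R) <= (n %/ ell N.+1).+1%:R by [].
have R0 : (0 : R) <= (RR N)%:R by [].
rewrite -mulrA -mulrA ler_pdivrMl//.
move: (RR N)%:R (n %/ gap N).+1%:R (n %/ ell N.+1).+1%:R (pp N)%:R (qq N)%:R (a n)
  aN Kp G1 l2 l0 p1 q0 R0 a0 => r G l p q z zr Kp G1 l2 l0 p1 q0 r0 z0.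
have s1 : G + p * l <= 3 * p * G by nra.
have s2 : r * (G + p * l) <= 15 * p * z.
  have := ler_wpM2l r0 s1; have : 3 * p * (r * G) <= 3 * p * (5 * z).
    by apply: ler_wpM2l => //; lra.
  by nra.
have s3 : 60 * p <= q * e.
  have : K%:R * p * e <= q * e by apply: ler_wpM2r => //; exact: ltW.
  have : 60 * p <= K%:R * e * p by apply: ler_wpM2r => //; lra.
  lra.
have := ler_wpM2r z0 s3; nra.
Qed.

(** Moving the first set by one step moves the summation index by one: the two sums share all terms
    but one each, and these are at most [m A]. *)
Lemma hits_shift V W n A B : inverse_mp mu V W -> fm A -> measurable B ->
  `|hits V n (V @^-1` A) B - hits V n A B| <= m A.
Proof.
move=> VW fA mB; have [mA _] := fA.
have mI k := measurable_iter VW k mB.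
case: n => [|n]; first by rewrite /visit_sum !big_ord0 subrr normr0 meas_ge0.
have fVA : fm (V @^-1` A) by exact: (fin_meas_iter VW 1).
have mVA : m (V @^-1` A) = m A by exact: (meas_iter VW 1).
rewrite /visit_sum big_ord_recl [X in _ - X]big_ord_recr/=.
have -> : \sum_(i < n) m (V @^-1` A `&` (fun x => V (iter i V x)) @^-1` B) =
          \sum_(i < n) m (A `&` iter i V @^-1` B).
  apply: eq_bigr => i _.
  rewrite -[RHS](meas_iter VW 1); last exact: measurableI.
  rewrite iter_setI; congr (m (_ `&` _)).
  by apply/seteqP; split => x /=; rewrite -iterS iterSr.
rewrite [X in `|X|](_ : _ = m (V @^-1` A `&` B) - m (A `&` iter n V @^-1` B)) ?ler_norml; last first.
  by rewrite -/(preimage id B) preimage_id; ring.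
have h1 : m (V @^-1` A `&` B) <= m A.
  by rewrite -mVA; apply: le_meas => //; apply: measurableI => //; case: fVA.
have h2 : m (A `&` iter n V @^-1` B) <= m A.
  by apply: le_meas => //; exact: measurableI.
have h3 := meas_ge0 mu (V @^-1` A `&` B).
have h4 := meas_ge0 mu (A `&` iter n V @^-1` B).
by move: h1 h2 h3 h4; rewrite ?preimage_id /=; lra.
Qed.

Lemma levi_T M i : (i.+1 < 2 * ell M)%N -> T @^-1` levi M i.+1 = levi M i.
Proof.
move=> iM; have [TK _ _ _ _] := TS; apply/seteqP; split => x; rewrite /nth_level /lev /= => E.
  have := @tow_S _ _ _ _ _ _ _ tow M (T x); rewrite TK E /inside => ->; lia.
rewrite (tow_T tow) E /inside; lia.
Qed.

Lemma levi_S M i : (i.+1 < 2 * ell M)%N -> S @^-1` levi M i = levi M i.+1.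
Proof.
move=> iM; have [_ SK _ _ _] := TS; apply/seteqP; split => x; rewrite /nth_level /lev /= => E.
  have := @tow_T _ _ _ _ _ _ _ tow M (S x); rewrite SK E /inside => ->; lia.
rewrite (tow_S tow) E /inside; lia.
Qed.

Lemma levi_drift M i n B : measurable B -> (i < 2 * ell M)%N ->
  `|hits T n (levi M i) B - hits T n (levi M 0) B| <= i%:R * ww M /\
  `|hits T n B (levi M i) - hits T n B (levi M 0)| <= i%:R * ww M.
Proof.
move=> mB; elim: i => [|i ih] iM; first by rewrite !subrr normr0 mul0r.
have {ih}[ih1 ih2] := ih (ltnW iM).
have ml j : measurable (levi M j) by case: (fin_meas_lev tow M (j%:Z - (ell M)%:Z)).
rewrite -natr1 mulrDl mul1r; split.
  have := hits_shift n TS (fin_meas_lev tow M (i.+1%:Z - (ell M)%:Z)) mB.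
  rewrite -/(levi M i.+1) (levi_T iM) (meas_lev tow) => h.
  have := ler_normD (hits T n (levi M i.+1) B - hits T n (levi M i) B)
     (hits T n (levi M i) B - hits T n (levi M 0) B).
  rewrite addrA subrK => /le_trans; apply; rewrite addrC.
  by apply: lerD => //; rewrite distrC.
have := hits_shift n (inverse_mp_sym TS) (fin_meas_lev tow M (i%:Z - (ell M)%:Z)) mB.
rewrite -/(levi M i) (levi_S iM) (meas_lev tow) -!(hits_dual n TS)// => h.
have := ler_normD (hits T n B (levi M i.+1) - hits T n B (levi M i))
   (hits T n B (levi M i) - hits T n B (levi M 0)).
rewrite addrA subrK => /le_trans; apply; rewrite addrC.
exact: lerD.
Qed.

(** Made to be used once for each argument of the correlation sums. The quotient [m Q / ww M] is the
    number of levels in [Q]. *)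
Lemma isL_linear M (Phi : set X -> R) Q c : isL M Q -> Phi set0 = 0 -> 0 <= c ->
  Phi Q = \sum_(i < 2 * ell M) Phi (Q `&` levi M i) ->
  (forall i, (i < 2 * ell M)%N -> `|Phi (levi M i) - Phi (levi M 0)| <= c) ->
  `|Phi Q - m Q / ww M * Phi (levi M 0)| <= (2 * ell M)%:R * c.
Proof.
move=> LQ P0 c0 PQ Pc.
rewrite PQ (meas_levels tow (isL_fm tow LQ) (isL_col LQ)) !mulr_suml -sumrB.
apply: (le_trans (ler_norm_sum _ _ _)).
have -> : (2 * ell M)%:R * c = \sum_(i < 2 * ell M) c.
  by rewrite sumr_const card_ord mulr_natl.
apply: ler_sum => i _.
case: (isL_levi LQ (ltn_ord i)) => ->.
  by rewrite (meas_lev tow) divff ?mul1r ?gt_eqF ?width_gt0//; exact: Pc.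
by rewrite P0 meas0 !mul0r subr0 normr0.
Qed.

Lemma visit_sum0l n B : hits T n set0 B = 0.
Proof. by apply: big1 => k _; rewrite set0I meas0. Qed.

Lemma visit_sum0r n B : hits T n B set0 = 0.
Proof. by apply: big1 => k _; rewrite preimage_set0 setI0 meas0. Qed.

(** The point is that [C] does not depend on [n], while the visits to the base are unbounded: all
    pairs of level unions thus have correlation sums asymptotically proportional to the product of
    their measures. *)
Lemma hits_levels M A B : isL M A -> isL M B -> exists C : R, forall n,
  `|hits T n A B - m A / ww M * (m B / ww M) * hits T n (levi M 0) (levi M 0)| <= C.
Proof.
move=> LA LB; have fA := isL_fm tow LA; have fB := isL_fm tow LB.
have [mA _] := fA; have [mB _] := fB.
have fl j : fm (levi M j) by exact: (fin_meas_lev tow).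
have ml j : measurable (levi M j) by case: (fl j).
pose c := (2 * ell M)%:R * ww M; have w0 := ltW (width_gt0 R M).
have c0 : 0 <= c by rewrite mulr_ge0.
have ic i : (i < 2 * ell M)%N -> i%:R * ww M <= c.
  by move=> iM; apply: ler_wpM2r => //; rewrite ler_nat ltnW.
have dj i j x : (i < j < 2 * ell M)%N -> levi M i x -> levi M j x -> False.
  by move=> /andP[ij _]; exact: levi_disj.
pose D := (2 * ell M)%:R * c.
exists (D + m A / ww M * D) => n.
have h1 : `|hits T n A B - m A / ww M * hits T n (levi M 0) B| <= D.
  apply: (@isL_linear M (fun Q => hits T n Q B)) => //.
  - exact: visit_sum0l.
  - rewrite (hits_dual n TS)// (hits_cover (inverse_mp_sym TS) n fB mA (fun i _ => ml i) dj).
      by apply: eq_bigr => i _; rewrite -(hits_dual n TS)//; exact: measurableI.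
    by move=> x /(isL_col LA)/col_levi.
  - by move=> i iM; have [h _] := levi_drift n mB iM; apply: le_trans h (ic _ iM).
have h2 : `|hits T n (levi M 0) B - m B / ww M * hits T n (levi M 0) (levi M 0)| <= D.
  apply: (@isL_linear M (fun Q => hits T n (levi M 0) Q)) => //.
  - exact: visit_sum0r.
  - rewrite (hits_cover TS n (fl 0%N) mB (fun i _ => ml i) dj)//.
    by move=> x /(isL_col LB)/col_levi.
  - by move=> i iM; have [_ h] := levi_drift n (ml 0%N) iM; apply: le_trans h (ic _ iM).
have t0 : 0 <= m A / ww M by rewrite divr_ge0// meas_ge0.
have := ler_wpM2l t0 h2; rewrite -{1}(ger0_norm t0) -normrM mulrBr => h3.
have := le_trans (ler_normD _ _) (lerD h1 h3).
by rewrite addrA subrK -(mulrA (m A / ww M)).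
Qed.

End WeakRatio.

(** * From unions of levels to all measurable subsets of the base *)

Section WeakRationalErgodicity.
Context d (X : measurableType d) (R : realType) (mu : {measure set X -> \bar R}).
Local Notation m := (meas mu).
Local Notation fm := (fin_meas mu).
Variables (T S : X -> X) (pos : nat -> X -> int).
Hypothesis tow : tower mu T S pos.

Local Notation isL := (level_union pos).
Local Notation levi := (nth_level pos).
Local Notation col := (column pos).
Local Notation hits := (visit_sum mu).
Local Notation ww := (width R).
Let TS : inverse_mp mu T S := tow_mp tow.
Let F := col 0%N.
Let fF : fm F := fin_meas_col tow 0%N.
Local Notation a n := (hits T n F F).

Lemma hits_col0_unbounded (c : R) : exists n0, forall n, (n0 <= n)%N -> c <= a n.
Proof.
pose K := (Num.truncn c).+1; exists (2 * ell K)%N => n nn.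
have [N nN] : exists N, (2 * ell N <= n < 2 * ell N.+1)%N.
  by apply: scale_ex; apply: leq_trans nn; have := ell_gt0 K; lia.
have [h _] := hits_col0_ge tow nN; apply: le_trans h.
apply: (@le_trans _ _ K%:R); first by rewrite ltW// truncnS_gt.
rewrite ler_nat; apply: leq_trans (RR_ge N).
by case/andP: nN => _; exact: scale_ge.
Qed.

Lemma approx_isL A (e : R) : fm A -> 0 < e -> exists N, forall M, (N <= M)%N ->
  exists A', [/\ isL M A', m (A `\` A') < e & m (A' `\` A) < e].
Proof.
move=> fA e0; have [N [P h]] := tow_approx tow fA e0.
exists N => M NM; exists (lset pos N P).
have g1 := meas_ge0 mu (A `\` lset pos N P); have g2 := meas_ge0 mu (lset pos N P `\` A).
split; [by apply: (isL_le tow NM); exists P|lra|lra].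
Qed.

Lemma approx_isL_sub A (e : R) : measurable A -> A `<=` F -> 0 < e ->
  exists N, forall M, (N <= M)%N ->
  exists A', [/\ isL M A', A' `<=` F, m (A `\` A') < e & m (A' `\` A) < e].
Proof.
move=> mA AF e0; have fA := fin_meas_sub fF mA AF.
have [N h] := approx_isL fA e0; exists N => M NM.
have [A' [LA' h1 h2]] := h _ NM.
have LF : isL M F by apply: (isL_le tow (leq0n M)); exact: isL_colN.
exists (A' `&` F); split => //.
- exact: isL_setI.
- rewrite (_ : A `\` _ = A `\` A')//; apply/seteqP; split => x /= [Ax].
    by move=> nx; split => // A'x; apply: nx; split => //; exact: AF.
  by move=> nA'; split => // -[].
- apply: le_lt_trans h2; apply: le_meas => //.
  + by apply: fin_measD => //; exact: (isL_fm tow LA').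
  + by apply: measurableD => //; apply: measurableI; [case: (isL_fm tow LA')|case: fF].
  + by move=> x [[]].
Qed.

Lemma hits_perturb A B A' B' n : measurable A -> measurable B ->
  measurable A' -> measurable B' -> A `<=` F -> B `<=` F ->
  A' `<=` F -> B' `<=` F ->
  hits T n A B <= hits T n A' B' + hits T n (A `\` A') F + hits T n F (B `\` B').
Proof.
move=> mA mB mA' mB' AF BF A'F B'F; have [mF _] := fF.
have fA := fin_meas_sub fF mA AF; have fA' := fin_meas_sub fF mA' A'F.
have mAA : measurable (A `&` A') by exact: measurableI.
have mAD : measurable (A `\` A') by exact: measurableD.
have mBB : measurable (B `&` B') by exact: measurableI.
have mBD : measurable (B `\` B') by exact: measurableD.
have fAA : fm (A `&` A') by exact: fin_measI.
have fAD : fm (A `\` A') by exact: fin_measD.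
rewrite (hits_splitl TS n fA mB mA') (hits_splitr TS n fAA mB mB').
rewrite -!addrA [X in _ + X]addrC addrA addrA; apply: lerD; first apply: lerD.
- by apply: (le_hits TS) => // x [].
- by apply: (le_hits TS).
- by apply: (le_hits TS) => // x [] /AF.
Qed.

Lemma meas_diff_le A A' (e : R) : fm A -> fm A' -> m (A `\` A') < e ->
  m (A' `\` A) < e -> `|m A - m A'| <= e.
Proof.
move=> fA fA'; have [mA _] := fA; have [mA' _] := fA'.
rewrite (meas_split fA mA') (meas_split fA' mA) [A' `&` A]setIC ler_norml.
have := meas_ge0 mu (A `\` A'); have := meas_ge0 mu (A' `\` A).
by move: (m (A `&` A')) => z; lra.
Qed.

Lemma hits_ratio A B : measurable A -> measurable B -> A `<=` F -> B `<=` F ->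
  (fun n => hits T n A B / a n) @ \oo --> m A * m B / m F ^+ 2.
Proof.
move=> mA mB AF BF; have fA := fin_meas_sub fF mA AF; have fB := fin_meas_sub fF mB BF.
rewrite (meas_col0 tow); apply/cvgrPdist_le => e e0.
(* The error is [22 + 1 + 1] times [dl]: [11 = 10 + 1] for each of the two sets replaced by a union
   of levels, one for the bounded error [C1 + C2], and one for the product of measures, whose error
   [4 * dl] is divided by [m F ^ 2 = 4]. *)
pose dl := e / 24; have d0 : 0 < dl by rewrite divr_gt0.
have [N1 h1] := approx_isL_sub mA AF d0; have [N2 h2] := approx_isL_sub mB BF d0.
pose M := maxn N1 N2.
have [A' [LA A'F AA1 AA2]] := h1 M (leq_maxl _ _).
have [B' [LB B'F BB1 BB2]] := h2 M (leq_maxr _ _).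
have fA' := isL_fm tow LA; have fB' := isL_fm tow LB.
have [mA' _] := fA'; have [mB' _] := fB'.
have LF : isL M F by apply: (isL_le tow (leq0n M)); exact: isL_colN.
have [C1 hC1] := hits_levels tow LA LB; have [C2 hC2] := hits_levels tow LF LF.
have [n1 hn1] := hits_sub_small tow d0.
have [n2 hn2] := hits_col0_unbounded (Num.max 1 ((C1 + C2) / dl)).
exists (maxn n1 n2) => // n /=; rewrite geq_max => /andP[nn1 nn2].
have an := hn2 _ nn2; move: an; rewrite ge_max => /andP[a1 aC].
have a0 : 0 < a n by exact: lt_le_trans a1.
have sub A1 A2 : measurable A1 -> measurable A2 -> A1 `<=` F -> m (A1 `\` A2) < dl ->
    hits T n (A1 `\` A2) F <= 11 * dl * a n /\ hits T n F (A1 `\` A2) <= 11 * dl * a n.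
  move=> m1 m2 A1F lt; have mD : measurable (A1 `\` A2) by exact: measurableD.
  have [|k1 k2] := hn1 n nn1 _ mD; first by move=> x [/A1F].
  have k : (10 * m (A1 `\` A2) + dl) * a n <= 11 * dl * a n.
    by apply: ler_wpM2r; [exact: ltW|lra].
  by split; [exact: le_trans k1 k|exact: le_trans k2 k].
have p1 : hits T n A B <= hits T n A' B' + 22 * dl * a n.
  have := hits_perturb n mA mB mA' mB' AF BF A'F B'F.
  have [k1 _] := sub _ _ mA mA' AF AA1; have [_ k2] := sub _ _ mB mB' BF BB1.
  by move: k1 k2; lra.
have p2 : hits T n A' B' <= hits T n A B + 22 * dl * a n.
  have := hits_perturb n mA' mB' mA mB A'F B'F AF BF.
  have [k1 _] := sub _ _ mA' mA A'F AA2; have [_ k2] := sub _ _ mB' mB B'F BB2.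
  by move: k1 k2; lra.
have dA := meas_diff_le fA fA' AA1 AA2; have dB := meas_diff_le fB fB' BB1 BB2.
have A2 : m A <= 2 by rewrite -(meas_col0 tow); exact: le_meas.
have B'2 : m B' <= 2 by rewrite -(meas_col0 tow); exact: le_meas.
have A'2 : m A' <= 2 by rewrite -(meas_col0 tow); exact: le_meas.
have := hC1 n; have := hC2 n; rewrite (meas_col0 tow).
have gA := meas_ge0 mu A; have gA' := meas_ge0 mu A'; have gB' := meas_ge0 mu B'.
have w0 := width_gt0 R M.
move: aC; rewrite ler_pdivrMr// => aC.
set s := hits T n (levi M 0) (levi M 0) => q2 q1.
have q : `|hits T n A' B' - m A' * m B' / 4 * a n| <= C1 + C2.
  have t0 : 0 <= m A' * m B' / 4 by rewrite divr_ge0// mulr_ge0.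
  have t1 : m A' * m B' / 4 <= 1 by nra.
  have : m A' * m B' / 4 * `|a n - 2 / ww M * (2 / ww M) * s| <= C2.
    by apply: le_trans q2; rewrite ler_piMl.
  rewrite -{1}(ger0_norm t0) -normrM => q3.
  have alg (h x y w : R) : w != 0 -> h - x * y / 4 * a n =
      (h - x / w * (y / w) * s) + x * y / 4 * (2 / w * (2 / w) * s - a n).
    by move=> wn0; field.
  rewrite (alg _ _ _ (ww M)) ?gt_eqF//.
  apply: (le_trans (ler_normD _ _)); apply: lerD => //.
  by move: q3; rewrite !normrM distrC.
have r : `|m A * m B - m A' * m B'| <= 4 * dl.
  rewrite (_ : _ - _ = m A * (m B - m B') + (m A - m A') * m B'); last by ring.
  apply: (le_trans (ler_normD _ _)); rewrite !normrM (ger0_norm gA) (ger0_norm gB').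
  have := normr_ge0 (m B - m B'); have := normr_ge0 (m A - m A'); nra.
rewrite -(ler_pM2r a0) -[X in _ * X <= _](gtr0_norm a0) -normrM mulrBl divfK ?gt_eqF//.
move: p1 p2 q r; rewrite !ler_norml => p1 p2 /andP[q3 q4] /andP[r1 r2].
have eE : e = 24 * dl by rewrite /dl; field.
rewrite eE (_ : 2 ^+ 2 = 4); last by ring.
have k1 : (m A * m B - m A' * m B') * a n <= 4 * dl * a n by apply: ler_wpM2r => //; exact: ltW.
have k2 : - (4 * dl) * a n <= (m A * m B - m A' * m B') * a n by apply: ler_wpM2r => //; exact: ltW.
move: p1 p2 q3 q4 k1 k2 aC.
have h1E : m A' * m B' / 4 * a n = m A' * m B' * a n / 4 by field.
have h2E : m A * m B / 4 * a n = m A * m B * a n / 4 by field.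
by rewrite h1E h2E mulrBl; lra.
Qed.

Lemma image_iter k A : iter k T @` A = iter k S @^-1` A.
Proof.
have [TK SK _ _ _] := TS; apply/seteqP; split => x /=.
  by move=> [y Ay <-]; rewrite (iter_cancel k TK).
by move=> Ax; exists (iter k S x); rewrite ?(iter_cancel k SK).
Qed.

(** Forward images are preimages under [S], and returning to preimages under [T] exchanges the roles
    of [A] and [B]. *)
Lemma mu_image n A B : measurable A -> A `<=` F -> measurable B ->
  (\sum_(0 <= k < n) mu (A `&` (iter k T @` B)) = (hits T n B A)%:E)%E.
Proof.
move=> mA AF mB; rewrite big_mkord -sumEFin; apply: eq_bigr => k _.
rewrite image_iter (meas_dual k TS mB mA) fin_measE//; apply: fin_measI.
  exact: fin_meas_sub fF mA AF.
exact: (measurable_iter (inverse_mp_sym TS)).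
Qed.

Lemma weak_ratio_limit A B : measurable A -> measurable B ->
  A `<=` F -> B `<=` F ->
  ((fun n : nat => (intrinsic_weight mu T F n)^-1
     * \sum_(0 <= k < n) mu (A `&` (iter k T @` B))) @ \oo --> mu A * mu B)%E.
Proof.
move=> mA mB AF BF; have [mF _] := fF.
have F1 : m F != 0 by rewrite (meas_col0 tow).
have F2 : m F ^+ 2 != 0 by rewrite expf_neq0.
have iwE n : intrinsic_weight mu T F n = (a n / m F ^+ 2)%:E.
  rewrite /intrinsic_weight -ge0_sume_distrl// mu_image// (fin_measE fF) -EFin_expe.
  by rewrite inver (negbTE F2).
rewrite (fin_measE (fin_meas_sub fF mA AF)) (fin_measE (fin_meas_sub fF mB BF)) -EFinM.
have [n0 hn0] := hits_col0_unbounded 1.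
have cv : (fun n => m F ^+ 2 * (hits T n B A / a n)) @ \oo --> m A * m B.
  rewrite (_ : m A * m B = m F ^+ 2 * (m B * m A / m F ^+ 2)); last first.
    by field.
  by apply: cvgMl_tmp; exact: hits_ratio.
have {}cv : (EFin \o (fun n => m F ^+ 2 * (hits T n B A / a n))) @ \oo --> (m A * m B)%:E.
  by apply: cvg_EFin => //; exact: nearW.
apply: cvg_trans cv; apply: near_eq_cvg; exists n0 => // n /= nn.
have a0 : 0 < a n by apply: lt_le_trans (hn0 _ nn).
rewrite iwE mu_image// inver mulf_eq0 invr_eq0 (negbTE F2) gt_eqF//=.
by rewrite -EFinM; congr (_%:E); field; rewrite F1 gt_eqF.
Qed.

End WeakRationalErgodicity.

(** * Failure of rational ergodicity *)

Lemma harmonic_tail (R : realType) N (s : R) :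
  exists j, s <= \sum_(i < j) (qq (N + i))%:R^-1.
Proof.
apply: contrapT => /forallNP h; apply: (@dvg_harmonic R).
have hE j : series (@harmonic R) (N + j)%N =
    series (@harmonic R) N + \sum_(i < j) (qq (N + i))%:R^-1.
  elim: j => [|j ih]; first by rewrite addn0 big_ord0 addr0.
  have := seriesSr (@harmonic R) (N + j)%N; rewrite -addnS => ->.
  by rewrite ih big_ord_recr/= addrA.
have nd : nondecreasing_seq (series (@harmonic R)).
  by apply: nondecreasing_series => n _ _; rewrite harmonic_ge0.
apply: nondecreasing_is_cvgn => //.
exists (series (@harmonic R) N + s) => _ [n _ <-].
apply: (@le_trans _ _ (series (@harmonic R) (N + n)%N)); first by apply: nd; exact: leq_addl.
rewrite hE lerD2l ltW// ltNge; apply/negP; exact: h.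
Qed.

Section NotRationallyErgodic.
Context d (X : measurableType d) (R : realType) (mu : {measure set X -> \bar R}).
Local Notation m := (meas mu).
Local Notation fm := (fin_meas mu).
Variables (T S : X -> X) (pos : nat -> X -> int).
Hypothesis tow : tower mu T S pos.

Local Notation isL := (level_union pos).
Local Notation col := (column pos).
Local Notation burst := (burst pos).
Local Notation hits := (visit_sum mu).
Local Notation ww := (width R).
Let TS : inverse_mp mu T S := tow_mp tow.

(* Second Borel-Cantelli: the bursts are independent of each other and their
   relative measures [1 / qq N] have a divergent sum. *)
Lemma burst_infinitely_often M G : measurable G -> G `<=` col M -> 0 < m G ->
  exists kappa : R, 0 < kappa /\ forall N1, exists N, (N1 <= N)%N /\
    kappa / (qq N)%:R <= m (G `&` burst N).
Proof.
move=> mG GM G0; have fG := fin_meas_sub (fin_meas_col tow M) mG GM.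
set M0 := m (col M); have M00 : 0 < M0.
  by apply: lt_le_trans G0 _; apply: le_meas => //; exact: (fin_meas_col tow).
(* If [G] misses the bound in all late bursts, remove bursts from the column until the sum of
   [1 / qq] first reaches [s0]. What remains of the column has measure at most [m G / 3], and
   [kappa] is chosen so that [G] has lost at most [m G / 3], a contradiction. The [+ 1] in [kappa]
   allows for the overshoot of the last term. *)
pose s0 := 3 * M0 / m G; have s00 : 0 < s0 by rewrite divr_gt0// mulr_gt0.
pose kappa := m G / (3 * (s0 + 1)).
have k0 : 0 < kappa by rewrite divr_gt0// mulr_gt0// addr_gt0.
exists kappa; split => // N1; apply: contrapT => /forallNP nh.
pose N2 := maxn M N1.
have h i : m (G `&` burst (N2 + i)) <= kappa / (qq (N2 + i))%:R.
  rewrite leNgt; apply/negP => /ltW hi; apply: (nh (N2 + i)%N); split => //.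
  by apply: (leq_trans (leq_maxr M N1)); exact: leq_addr.
pose Q := fix Q j := if j is j'.+1 then Q j' `\` burst (N2 + j') else col M.
pose s j := \sum_(i < j) (qq (N2 + i))%:R^-1 : R.
have sS j : s j.+1 = s j + (qq (N2 + j))%:R^-1 by rewrite /s big_ord_recr.
have s_ge0 j : 0 <= s j by apply: sumr_ge0.
have LQ j : isL (N2 + j) (Q j).
  elim: j => [|j ih] /=.
    by rewrite addn0; apply: (isL_le tow (leq_maxl M N1)); exact: isL_colN.
  rewrite addnS; apply: isL_setD; first exact: (isL_step tow).
  exact: isL_burst.
have fQ j : fm (Q j) by exact: (isL_fm tow (LQ j)).
have mb N : measurable (burst N) := measurable_burst tow N.
have q1 N : (qq N)%:R^-1 <= 1 :> R by rewrite invf_le1 ?ler1n.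
have q0 N : 0 < (qq N)%:R^-1 :> R by rewrite invr_gt0.
have decay j : m (Q j) * (1 + s j) <= M0.
  elim: j => [|j ih]; first by rewrite /s big_ord0 addr0 mulr1.
  have := meas_split (fQ j) (mb (N2 + j)%N); rewrite (meas_isL_burst tow (LQ j)).
  rewrite -/(Q j.+1) sS; move: ih (q1 (N2 + j)%N) (q0 (N2 + j)%N) (s_ge0 j) (meas_ge0 mu (Q j)).
  move: (m (Q j)) (m (Q j.+1)) (s j) (_^-1) => x y z t xz t1 t0 z0 x0 xE.
  have -> : y = (1 - t) * x by lra.
  have h1 : 0 <= x * t * z by rewrite !mulr_ge0// ltW.
  have h2 : 0 <= x * t * t by rewrite !mulr_ge0// ltW.
  lra.
have grow j : m G - kappa * s j <= m (G `&` Q j).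
  elim: j => [|j ih]; first by rewrite /s big_ord0 mulr0 subr0 /= setIidl.
  have [mQ _] := fQ j.
  have fGQ : fm (G `&` Q j) by exact: fin_measI.
  have := meas_split fGQ (mb (N2 + j)%N); rewrite -/(Q j.+1).
  rewrite (_ : _ `\` _ = G `&` Q j.+1); last first.
    by apply/seteqP; split => x /=; tauto.
  have : m (G `&` Q j `&` burst (N2 + j)) <= m (G `&` burst (N2 + j)).
    by apply: le_meas; [exact: fin_measI|apply: measurableI => //; exact: measurableI|move=> x [[]]].
  by have := h j; rewrite sS mulrDr; move: ih; lra.
have [j0 hj0] := harmonic_tail N2 s0.
have ex : exists j, s0 <= s j by exists j0.
case: (ex_minnP ex) => -[|j] sj jmin; first by move: sj; rewrite /s big_ord0; lra.
have sj1 : s j < s0.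
  by rewrite ltNge; apply/negP => /jmin; rewrite ltnn.
have s1 : s j.+1 <= s0 + 1 by rewrite sS; have := q1 (N2 + j)%N; lra.
have e1 : m G <= m (Q j.+1) + kappa * s j.+1.
  have := grow j.+1; have : m (G `&` Q j.+1) <= m (Q j.+1).
    by apply: le_meas => //; exact: measurableI mG (fQ j.+1).1.
  lra.
have e2 : m (Q j.+1) <= m G / 3.
  have := decay j.+1; have g := meas_ge0 mu (Q j.+1).
  have : m (Q j.+1) * s0 <= m (Q j.+1) * (1 + s j.+1).
    by apply: ler_wpM2l => //; lra.
  have sE : s0 * m G = 3 * M0 by rewrite /s0 divfK// gt_eqF.
  nra.
have e3 : kappa * s j.+1 <= m G / 3.
  have : kappa * s j.+1 <= kappa * (s0 + 1) by apply: ler_wpM2l => //; exact: ltW.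
  have : kappa * (s0 + 1) = m G / 3 by rewrite /kappa; field; lra.
  lra.
lra.
Qed.

(** At time [gap N] the sparse part gives [2], and the burst part gives [(2 + pp N) / qq N <= 3];
    hence the constant 5. *)
Lemma hits_gap_le M N G : (M <= N)%N -> measurable G -> G `<=` col M ->
  hits T (gap N) G G <= 5 * (RR N)%:R * m (col M) ^+ 2.
Proof.
move=> MN mG GM; have fQ := fin_meas_col tow M; have [mQ _] := fQ.
have LQ : isL N (col M) by apply: (isL_le tow MN); exact: isL_colN.
apply: (@le_trans _ _ (hits T (gap N) (col M) (col M))); first exact: (le_hits TS).
have [h _] := hits_sub tow (gap N) LQ mQ (fun _ h => h).
apply: (le_trans h); rewrite divnn gap_gt0 divn_small; last first.
  by rewrite ellS; have := rr_gt0 N; have := gap_gt0 N; nia.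
have p1 : (pp N)%:R <= (qq N)%:R :> R by rewrite ler_nat pp_le_qq.
have q1 : (1 : R) <= (qq N)%:R by rewrite ler1n.
have b : (qq N)%:R^-1 * (2 + (pp N)%:R * 1) <= 3 :> R.
  by rewrite ler_pdivrMl; lra.
have c0 : 0 <= m (col M) ^+ 2 * (RR N)%:R by rewrite mulr_ge0// sqr_ge0.
have := ler_wpM2r c0 b.
rewrite /=; move: ((qq N)%:R^-1) (m (col M)) (RR N)%:R (pp N)%:R => x y z t h3.
have -> : x * y ^+ 2 * z * (2 + t * 1) = x * (2 + t * 1) * (y ^+ 2 * z) by ring.
lra.
Qed.

(** The burst is a run of exactly [gap N] levels of the next column, so [hits_run] applies with run
    length and time both equal to [gap N]. *)
Lemma hits_burst_ge N H : fm H -> H `<=` burst N ->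
  m H ^+ 2 * (RR N.+1)%:R <= 4 * hits T (gap N) H H.
Proof.
move=> fH HB.
have aN : - (ell N.+1)%:Z <= - (ell N)%:Z.
  by have := ell_mono (leqnSn N); lia.
have aK : - (ell N)%:Z + (gap N)%:Z <= (ell N.+1)%:Z.
  by rewrite ellS mulSn; lia.
have := hits_run tow (gap N) fH aN aK _.
have HY : H `<=` lset pos N.+1 [set g | - (ell N)%:Z <= g < - (ell N)%:Z + (gap N)%:Z].
  by move=> x /HB [xr /= xb]; split => //=; move: xb; rewrite /gap; lia.
move=> /(_ HY); have g0 : (0 : R) < (gap N)%:R by rewrite ltr0n gap_gt0.
have R0 : (0 : R) < (RR N.+1)%:R by rewrite ltr0n RR_gt0.
rewrite /width natrD -(ler_pM2r R0) => h; rewrite -(ler_pM2l g0); move: h.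
move: (RR N.+1)%:R R0 (gap N)%:R (hits _ _ _ _) (m H) => r r0 g z t.
rewrite (_ : 2 * _ * z * r = g * (4 * z)); last by field; rewrite gt_eqF.
by rewrite -mulrA.
Qed.

Lemma not_rationally_ergodic : ~ rationally_ergodic mu T.
Proof.
move=> [_ _ [F [mF F0 Foo re]]].
have fF : fm F by split.
have {}F0 : 0 < m F by rewrite -lte_fin -fin_measE.
have [c [c0 [n0 hn0]]] := rationally_ergodic_bound TS fF F0 re.
(* The second moment is at most [a ^ 2 / c], where [a] is the first moment, so by Cauchy-Schwarz a
   part of measure below [c / 16] accounts for at most [a / 4] on either side, and [G] keeps half of
   the visits. The bound [m F / 2] keeps [G] of positive measure. *)
pose dl := Num.min (c / 16) (m F / 2).
have dl0 : 0 < dl by rewrite lt_min !divr_gt0.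
have [M hM] := approx_isL tow fF dl0.
have [A' [LA hA _]] := hM M (leqnn M).
have [mC _] := fin_meas_col tow M.
set D := F `\` col M; set G := F `&` col M.
have mD : measurable D by exact: measurableD.
have mG : measurable G by exact: measurableI.
have Dd : m D < dl.
  apply: le_lt_trans hA; apply: le_meas => //.
    by apply: fin_measD => //; case: (isL_fm tow LA).
  by move=> x [Fx nx]; split => // /(isL_col LA).
have [Dc DF] : m D < c / 16 /\ m D < m F / 2.
  by apply/andP; rewrite -lt_min.
have G0 : 0 < m G by have := meas_split fF mC; rewrite -/G -/D; lra.
have fG : fm G by exact: fin_measI.
have fD : fm D by exact: fin_measD.
have aG n : (n0 <= n)%N -> hits T n F F <= 2 * hits T n G G.
  move=> nn; set a := hits T n F F.
  have a0 : 0 <= a by exact: hits_ge0.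
  have h := hn0 _ nn; rewrite -/a in h.
  have q0 : 0 <= hits2 mu T n F.
    by do 2!apply: sumr_ge0 => ? _; exact: meas_ge0.
  have sm z : 0 <= z -> z ^+ 2 <= m D * hits2 mu T n F -> z <= a / 4.
    move=> z0 hz; rewrite -(ler_pXn2r (n := 2))//; last by rewrite nnegrE; lra.
    apply: (le_trans hz).
    have : m D * hits2 mu T n F <= c / 16 * hits2 mu T n F.
      by apply: ler_wpM2r => //; exact: ltW.
    move: h; rewrite exprMn; move: (hits2 mu T n F) => y.
    by rewrite (_ : 4^-1 ^+ 2 = 16^-1 :> R); [lra|field].
  have d1 : hits T n D F <= a / 4.
    by apply: sm; [exact: hits_ge0|apply: (hits_sqr_le TS) => // x []].
  have d2 : hits T n F D <= a / 4.
    apply: sm; first exact: hits_ge0.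
    rewrite (hits_dual n TS)// (hits2_dual TS)//.
    by apply: (hits_sqr_le (inverse_mp_sym TS)) => // x [].
  have d3 : hits T n G D <= hits T n F D by apply: (le_hits TS) => // x [].
  have e1 : a = hits T n G F + hits T n D F by exact: (hits_splitl TS).
  have e2 : hits T n G F = hits T n G G + hits T n G D by exact: (hits_splitr TS).
  by move: e1 e2 d1 d2 d3; lra.
have GM : G `<=` col M by move=> x [].
have [kappa [k0 hk]] := burst_infinitely_often mG GM G0.
(* [1600 = 4 ^ 2 * 10 ^ 2]: the [4] is the loss in [hits_burst_ge], and [10 = 2 * 5] combines [aG]
   with [hits_gap_le]. This gives [m H ^ 3 * (pp * qq) ^ 2 <= B], hence
   [kappa ^ 3 * pp ^ 2 / qq <= B], which [K] contradicts through [cbrt_qq]. *)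
pose B := 1600 * m (col M) ^+ 4 / c.
pose K := (Num.truncn (8 * B / kappa ^+ 3)).+1.
have KB : 8 * B < K%:R * kappa ^+ 3.
  by rewrite -ltr_pdivrMr ?exprn_gt0// truncnS_gt.
have [N [NN hN]] := hk (maxn (maxn M n0) (K ^ 3)).
move: NN; rewrite !geq_max -andbA => /and3P[MN n0N KN].
have mb := measurable_burst tow N.
set H := G `&` burst N in hN.
have fH : fm H by exact: fin_measI.
have HF : H `<=` F by move=> x [[]].
have [mH _] := fH.
have gn : (n0 <= gap N)%N := leq_trans n0N (ltnW (gap_gt N)).
have h1 := hn0 _ gn; have h2 := aG _ gn.
have h3 := hits_gap_le MN mG GM.
have h4 : m H ^+ 2 * (RR N.+1)%:R <= 4 * hits T (gap N) H H.
  by apply: hits_burst_ge => // x [].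
have h5 : hits T (gap N) H H <= hits T (gap N) H F by exact: (le_hits TS).
have h6 := hits_sqr_le TS (gap N) fF mH HF.
have q0 : (0 : R) < (qq N)%:R by rewrite ltr0n.
have H0 : 0 < m H by apply: lt_le_trans hN; rewrite divr_gt0.
have R0 : (0 : R) < (RR N)%:R by rewrite ltr0n RR_gt0.
have p0 : (0 : R) < (pp N)%:R by rewrite ltr0n pp_gt0.
have a0 : 0 <= hits T (gap N) F F by exact: hits_ge0.
rewrite RRS /rr (natrM _ (RR N)) (natrM _ (pp N)) in h4.
have Kp : K%:R * (qq N)%:R <= 8 * (pp N)%:R ^+ 2 :> R.
  rewrite -natrX -!natrM ler_nat; apply: leq_trans (cbrt_qq N).
  by rewrite leq_mul2r; apply/orP; right; apply/leq_cbrt/leqW.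
have kap : kappa <= m H * (qq N)%:R by rewrite -ler_pdivrMr.
have main : m H ^+ 3 * ((pp N)%:R * (qq N)%:R) ^+ 2 <= B.
  rewrite /B ler_pdivlMr//.
  have H5 : hits T (gap N) F F <= 10 * ((RR N)%:R * m (col M) ^+ 2) by lra.
  have H6 : hits T (gap N) F F ^+ 2 <= (10 * ((RR N)%:R * m (col M) ^+ 2)) ^+ 2.
    by rewrite ler_pXn2r// nnegrE; [exact: le_trans a0 H5].
  have f0 := hits_ge0 mu T (gap N) H F.
  have H7 : (m H ^+ 2 * ((RR N)%:R * ((pp N)%:R * (qq N)%:R))) ^+ 2 <=
      (4 * hits T (gap N) H F) ^+ 2.
    rewrite ler_pXn2r// ?nnegrE; [by lra| |lra].
    by rewrite !mulr_ge0// ?sqr_ge0// ltW.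
  have tR : 0 < m H * (RR N)%:R ^+ 2 by rewrite mulr_gt0// exprn_gt0.
  rewrite -(ler_pM2l tR).
  have H8 : c * hits T (gap N) H F ^+ 2 <= m H * hits T (gap N) F F ^+ 2.
    apply: (@le_trans _ _ (m H * (c * hits2 mu T (gap N) F))).
      by rewrite [leRHS]mulrCA; apply: ler_wpM2l => //; exact: ltW.
    by apply: ler_wpM2l => //; exact: ltW.
  have H9 := ler_wpM2l (ltW c0) H7; have H10 := ler_wpM2l (ltW H0) H6.
  move: H8 H9 H10; move: (hits T (gap N) F F) (hits T (gap N) H F) => a f.
  move: (m H) (RR N)%:R (pp N)%:R (qq N)%:R (m (col M)) => t r p q z H8 H9 H10.
  have -> : t * r ^+ 2 * (t ^+ 3 * (p * q) ^+ 2 * c) =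
    c * (t ^+ 2 * (r * (p * q))) ^+ 2 by ring.
  have -> : t * r ^+ 2 * (1600 * z ^+ 4) = 16 * (t * (10 * (r * z ^+ 2)) ^+ 2) by ring.
  have E : c * (4 * f) ^+ 2 = 16 * (c * f ^+ 2) by ring.
  by rewrite E in H9; lra.
have k3 : kappa ^+ 3 <= (m H * (qq N)%:R) ^+ 3.
  by rewrite ler_pXn2r// nnegrE; apply: ltW => //; exact: lt_le_trans kap.
have kp0 : 0 < kappa ^+ 3 by rewrite exprn_gt0.
have s1 := ler_wpM2l (ltW kp0) Kp.
have s2 : kappa ^+ 3 * (8 * (pp N)%:R ^+ 2) <=
    (m H * (qq N)%:R) ^+ 3 * (8 * (pp N)%:R ^+ 2).
  by apply: ler_wpM2r => //; rewrite mulr_ge0// sqr_ge0.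
have s3 := ler_wpM2l (ltW q0) main.
have s4 : (qq N)%:R * (8 * B) < (qq N)%:R * (K%:R * kappa ^+ 3) by rewrite ltr_pM2l.
move: s1 s2 s3 s4; move: (m H) (qq N)%:R (pp N)%:R (kappa ^+ 3) K%:R => t q p k K'.
have -> : (t * q) ^+ 3 * (8 * p ^+ 2) = 8 * (q * (t ^+ 3 * (p * q) ^+ 2)) by ring.
have -> : k * (K' * q) = q * (K' * k) by ring.
lra.
Qed.

End NotRationallyErgodic.

(** * Ergodicity *)

(* Half of a wandering set of positive measure has an orbit which is neither
   null nor conull. *)
Lemma ergodic_conservative (R : realType) d (X : measurableType d)
    (mu : {measure set X -> \bar R}) (T S : X -> X) :
  inverse_mp mu T S -> nonatomic mu -> ergodic mu T -> conservative mu T.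
Proof.
move=> TS na erg W mW dW; apply/eqP; rewrite -[_ == _]negbK -measure_gt0.
apply/negP => W0; have [TK SK _ _ _] := TS.
have [B [mB BW B0 BltW]] := na W mW W0.
have dWx k x : (0 < k)%N -> W x -> W (iter k T x) -> False.
  move=> k0 Wx Wkx; have := dW 0%N k I I; have /[swap]/[apply] :
      (iter 0 T @^-1` W `&` iter k T @^-1` W) !=set0 by exists x.
  by move=> k00; rewrite -k00 in k0.
pose A := (\bigcup_k (iter k T @^-1` B)) `|` (\bigcup_k (iter k S @^-1` B)).
have mA : measurable A.
  by apply: measurableU; apply: bigcupT_measurable => k;
    [exact: (measurable_iter TS)|exact: (measurable_iter (inverse_mp_sym TS))].
have TA : T @^-1` A = A.
  apply/seteqP; split => x /=.
    move=> [[k _ /= h]|[[|k] _ /= h]].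
    - by left; exists k.+1 => //=; rewrite -iterS iterSr.
    - by left; exists 1%N.
    - by right; exists k => //=; move: h; rewrite -iterS iterSr TK.
  move=> [[[|k] _ /= h]|[k _ /= h]].
  - by right; exists 1%N => //=; rewrite TK.
  - by left; exists k => //=; move: h; rewrite -iterS iterSr.
  - by right; exists k.+1 => //=; rewrite -iterS iterSr TK.
have BA : B `<=` A by move=> x Bx; left; exists 0%N.
have [A0|A0] := erg A mA TA.
  by move: B0; rewrite measure_gt0 (subset_measure0 _ _ BA A0)// eqxx.
(* No orbit meets the wandering set twice, so [W] without [B] avoids the full orbit [A] of [B]. *)
have WB0 : mu (W `\` B) = 0%E.
  apply: (subset_measure0 _ _ _ A0) => //; [exact: measurableD|exact: measurableC|].
  move=> x [Wx nBx] [[[|k] _ /= h]|[[|k] _ /= h]] //.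
    by apply: (dWx k.+1 x) => //; exact: BW.
  apply: (dWx k.+1 (iter k.+1 S x)) => //; first exact: BW.
  by rewrite (iter_cancel k.+1 SK).
have WE : (mu W = mu (W `\` B) + mu (W `&` B))%E by exact: measureDI.
by move: BltW; rewrite WE WB0 add0e setIC setIidl// ltxx.
Qed.

Section Ergodicity.
Context d (X : measurableType d) (R : realType) (mu : {measure set X -> \bar R}).
Local Notation m := (meas mu).
Local Notation fm := (fin_meas mu).
Variables (T S : X -> X) (pos : nat -> X -> int).
Hypothesis tow : tower mu T S pos.

Local Notation isL := (level_union pos).
Local Notation levi := (nth_level pos).
Local Notation col := (column pos).
Local Notation ww := (width R).
Let TS : inverse_mp mu T S := tow_mp tow.

Lemma mu_cover0 A : measurable A -> (forall N, m (A `&` col N) = 0) -> mu A = 0%E.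
Proof.
move=> mA A0.
have -> : A = \bigcup_N (A `&` col N).
  rewrite -setI_bigcupr setIidl// => x _.
  by have [N xN] := tow_cover tow x; exists N.
apply: measure_negligible.
  by apply: bigcupT_measurable => N; apply: measurableI => //; case: (fin_meas_col tow N).
have AN0 N : mu (A `&` col N) = 0%E.
  by rewrite (fin_measE (fin_measIr (fin_meas_col tow N) mA)) A0.
apply: negligible_bigcup => N; apply/negligibleP; last exact: AN0.
by apply: measurableI => //; case: (fin_meas_col tow N).
Qed.

Section Invariant.
Variable A : set X.
Hypotheses (mA : measurable A) (TA : T @^-1` A = A).

Lemma invariant_levi N i : (i < 2 * ell N)%N ->
  m (A `&` levi N i) = m (A `&` levi N 0).
Proof.
elim: i => // i ih iN; rewrite -ih ?(ltnW iN)// -(levi_T tow iN) -{2}TA.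
rewrite -preimage_setI; symmetry; apply: (meas_iter TS 1).
by apply: measurableI => //; case: (fin_meas_lev tow N (i.+1%:Z - (ell N)%:Z)).
Qed.

Lemma invariant_isL N Q : isL N Q ->
  m (A `&` Q) = m (A `&` levi N 0) / ww N * m Q.
Proof.
move=> LQ; have fQ := isL_fm tow LQ; have QN := isL_col LQ.
have fAQ : fm (A `&` Q) by exact: fin_measIr.
rewrite (meas_levels tow fAQ (N := N)); last by move=> x [_ /QN].
rewrite (meas_levels tow fQ QN) mulr_sumr; apply: eq_bigr => i _.
rewrite -setIA; case: (isL_levi LQ (ltn_ord i)) => ->.
  rewrite invariant_levi// (meas_lev tow) divfK// gt_eqF//; exact: width_gt0.
by rewrite setI0 meas0 mulr0.
Qed.

Let alpha := m (A `&` col 0) / m (col 0).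

Lemma invariant_density N Q : isL N Q -> m (A `&` Q) = alpha * m Q.
Proof.
move=> LQ; rewrite (invariant_isL LQ); congr (_ * _).
have L0 : isL N (col 0) by apply: (isL_le tow (leq0n N)); exact: isL_colN.
by rewrite /alpha (invariant_isL L0) mulfK// (meas_col0 tow).
Qed.

(** An invariant set has the same density [alpha] in all levels of all columns, and these
    approximate every set of finite measure. Applied to parts of the complement of [A], this forces
    [alpha] to be 0 or the complement to be null. *)
Lemma invariant_indep B : fm B -> m (A `&` B) = alpha * m B.
Proof.
move=> fB; have [mB _] := fB.
have al0 : 0 <= alpha by rewrite divr_ge0// meas_ge0.
have al1 : alpha <= 1.
  rewrite ler_pdivrMr ?mul1r ?(meas_col0 tow)// -(meas_col0 tow).
  by apply: le_meas; [exact: fin_meas_col tow 0%N|apply: measurableI => //; case: (fin_meas_col tow 0%N)|move=> x []].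
apply/eqP; rewrite -subr_eq0 -normr_le0; apply/ler_addgt0Pr => e e0; rewrite add0r.
have e40 : 0 < e / 2 by rewrite divr_gt0.
have [N hN] := approx_isL tow fB e40; have [Q [LQ h1 h2]] := hN N (leqnn N).
have fQ := isL_fm tow LQ; have [mQ _] := fQ.
have d1 := meas_diff_le fB fQ h1 h2.
have fAB : fm (A `&` B) by exact: fin_measIr.
have fAQ : fm (A `&` Q) by exact: fin_measIr.
have d2 : `|m (A `&` B) - m (A `&` Q)| <= e / 2.
  apply: meas_diff_le => //.
    apply: le_lt_trans h1; apply: le_meas; first exact: fin_measD.
      by apply: measurableD; [exact: measurableI|exact: measurableI].
    by move=> x [[Ax Bx] nx]; split => // Qx; apply: nx.
  apply: le_lt_trans h2; apply: le_meas; first exact: fin_measD.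
    by apply: measurableD; [exact: measurableI|exact: measurableI].
  by move=> x [[Ax Bx] nx]; split => // Qx; apply: nx.
have h := invariant_density LQ.
rewrite (_ : _ - _ = (m (A `&` B) - m (A `&` Q)) - alpha * (m B - m Q)); last first.
  by rewrite h; ring.
apply: (le_trans (ler_normB _ _)); rewrite normrM (ger0_norm al0).
have : alpha * `|m B - m Q| <= 1 * (e / 2) by apply: ler_pM.
by lra.
Qed.

Lemma invariant_trivial : mu A = 0%E \/ mu (~` A) = 0%E.
Proof.
have [a0|a0] := eqVneq alpha 0; [left|right]; apply: mu_cover0 => //.
- by move=> N; rewrite (invariant_indep (fin_meas_col tow N)) a0 mul0r.
- exact: measurableC.
- move=> N; have fB : fm (~` A `&` col N).
    by apply: fin_measIr; [exact: fin_meas_col tow N|exact: measurableC].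
  have := invariant_indep fB; rewrite setIA setICr set0I meas0 => /esym/eqP.
  by rewrite mulf_eq0 (negbTE a0) => /eqP.
Qed.

End Invariant.

Lemma tower_ergodic : ergodic mu T.
Proof. by move=> A mA TA; exact: invariant_trivial. Qed.

Lemma tower_weakly_rationally_ergodic : nonatomic mu ->
  weakly_rationally_ergodic mu T.
Proof.
move=> na; split.
- by apply: (ergodic_conservative TS na); exact: tower_ergodic.
- exact: tower_ergodic.
- exists (col 0); have [mF Foo] := fin_meas_col tow 0%N; split => //.
    by rewrite (fin_measE (fin_meas_col tow 0%N)) (meas_col0 tow) lte_fin.
  by move=> A B mA mB AF BF; exact: (weak_ratio_limit tow).
Qed.

End Ergodicity.

(** * Construction on the line *)

(** The complements of [D] and of its image have the same cardinality; their enumerations are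
    matched index by index. *)
Lemma perm_extension (I : finType) (D : {set I}) (f : I -> I) :
  {in D &, injective f} -> exists s : {perm I}, {in D, s =1 f}.
Proof.
move=> fI; have cD : #|~: D| = #|~: (f @: D)|.
  by apply/eqP; rewrite -(eqn_add2l #|D|) cardsC -(card_in_imset fI) cardsC.
pose g x := if x \in D then f x
  else nth x (enum (~: (f @: D))) (index x (enum (~: D))).
have idx x : x \notin D -> (index x (enum (~: D)) < size (enum (~: (f @: D))))%N.
  by move=> xD; rewrite -cardE -cD cardE index_mem mem_enum inE.
have gC x : x \notin D -> g x \notin f @: D.
  move=> xD; rewrite /g (negbTE xD).
  by have := mem_nth x (idx _ xD); rewrite mem_enum inE.
have gI : injective g.
  move=> x y; have [xD|xD] := boolP (x \in D); have [yD|yD] := boolP (y \in D).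
  - by rewrite /g xD yD; exact: fI.
  - by move=> E; have := gC _ yD; rewrite -E /g xD imset_f.
  - by move=> E; have := gC _ xD; rewrite E /g yD imset_f.
  - rewrite /g (negbTE xD) (negbTE yD) (set_nth_default x _ (idx _ yD)) => /eqP.
    rewrite nth_uniq ?enum_uniq ?idx// => /eqP E.
    by apply: (index_inj x _ _ E); rewrite mem_enum inE.
exists (perm gI) => x xD; by rewrite permE /g xD.
Qed.

Lemma int_perm_extension (L : nat) (D : pred int) (f : int -> int) :
  (forall e, D e -> - L%:Z <= e < L%:Z) ->
  (forall e, D e -> - L%:Z <= f e < L%:Z) ->
  {in D &, injective f} ->
  exists pi rho : int -> int, [/\ cancel pi rho, cancel rho pi,
    {in D, pi =1 f} &
    forall e, (- L%:Z <= pi e < L%:Z) = (- L%:Z <= e < L%:Z)].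
Proof.
case: L => [|L] DL fL fI.
  exists id, id; split => // e /DL; lia.
pose toI (e : int) : 'I_(L.+1 + L.+1) := inord (absz (e + L.+1%:Z)).
pose ofI (i : 'I_(L.+1 + L.+1)) : int := (i : nat)%:Z - L.+1%:Z.
pose In (e : int) := - L.+1%:Z <= e < L.+1%:Z.
have ofK : cancel ofI toI.
  move=> i; apply: val_inj; rewrite /toI /ofI subrK/= inordK//.
have toK e : In e -> ofI (toI e) = e.
  rewrite /In => eL; rewrite /ofI /toI inordK; first lia.
  by change (absz (e + L.+1%:Z)%R < L.+1 + L.+1)%N; lia.
have ofIn i : In (ofI i) by rewrite /In /ofI; have := ltn_ord i; lia.
have [|s hs] := @perm_extension _ [set i | D (ofI i)] (toI \o f \o ofI).
  move=> i j; rewrite !inE => Di Dj /= E; apply: (can_inj ofK); apply: fI => //.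
  by rewrite -(toK _ (fL _ Di)) -(toK _ (fL _ Dj)) E.
pose lift (t : {perm 'I_(L.+1 + L.+1)}) e := if In e then ofI (t (toI e)) else e.
have liftIn t e : In (lift t e) = In e.
  by rewrite /lift; case: ifP => // eI; rewrite ofIn.
have liftK (t t' : {perm 'I_(L.+1 + L.+1)}) : cancel t t' -> cancel (lift t) (lift t').
  move=> tK e; rewrite {1}/lift liftIn; case: ifP => eI; last by rewrite /lift eI.
  by rewrite /lift eI ofK tK toK.
exists (lift s), (lift s^-1%g); split.
- by apply: liftK; exact: permK.
- by apply: liftK; exact: permKV.
- move=> e De; have eI : In e by exact: DL.
  have eE := toK _ eI.
  by rewrite /lift eI hs ?inE ?eE//= eE toK//; exact: fL.
- by move=> e; rewrite -/(In _) liftIn.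
Qed.

Lemma divz_modz_inside N (e : int) :
  let q := (e %/ (rr N)%:Z)%Z in let s := (e %% (rr N)%:Z)%Z in
  [/\ e = q * (rr N)%:Z + s, 0 <= s & s < (rr N)%:Z].
Proof.
have r0 : (rr N)%:Z != 0 by rewrite eqz_nat -lt0n rr_gt0.
split; [exact: divz_eq|exact: modz_ge0|].
by apply: ltz_pmod; rewrite ltz_nat rr_gt0.
Qed.

(** Cutting and stacking prescribes the heights of the addresses that subdivide the [N]-th column.
    This partial map is injective by [cpos_inj]; extending it to a permutation of the larger window
    assigns the remaining addresses to the spacer heights. *)
Lemma address_step N (pi rho : int -> int) :
  cancel pi rho -> (forall e, inside N (pi e) = inside N e) ->
  exists pi' rho' : int -> int, [/\ cancel pi' rho', cancel rho' pi',
    (forall e, inside N.+1 (pi' e) = inside N.+1 e) &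
    forall e, inside N (e %/ (rr N)%:Z)%Z ->
      pi' e = (cpos N (absz (e %% (rr N)%:Z)%Z))%:Z + pi (e %/ (rr N)%:Z)%Z].
Proof.
move=> piK piN.
pose D (e : int) := inside N (e %/ (rr N)%:Z)%Z.
pose f (e : int) := (cpos N (absz (e %% (rr N)%:Z)%Z))%:Z + pi (e %/ (rr N)%:Z)%Z.
have sr e : (absz (e %% (rr N)%:Z)%Z < rr N)%N.
  by have [_ s0 s1] := divz_modz_inside N e; lia.
have [| | |pi' [rho' [h1 h2 h3 h4]]] := @int_perm_extension (ell N.+1) D f.
- move=> e; rewrite /D /inside; have [] := divz_modz_inside N e.
  move: (e %/ (rr N)%:Z)%Z (e %% (rr N)%:Z)%Z => q s -> s0 s1 /andP[q1 q2].
  have h : (rr N * ell N <= ell N.+1)%N.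
    by rewrite ellS; have := gap_ge N; have := rr_gt0 N; nia.
  move: q1 q2 s0 s1 h; move: (rr N) (ell N) (ell N.+1) => r l l' q1 q2 s0 s1 h.
  nia.
- by move=> e De; apply: inside_cpos; rewrite ?piN.
- move=> e1 e2; rewrite -!topredE /= /D => D1 D2; rewrite /f => /(cpos_inj _ _)[].
  + by move: D1; rewrite -piN.
  + by move: D2; rewrite -piN.
  + move=> sE /(can_inj piK) qE.
    have [-> s0 _] := divz_modz_inside N e1; have [-> s0' _] := divz_modz_inside N e2.
    by rewrite qE; congr (_ + _); lia.
- by exists pi', rho'; split => // e De; exact: h3.
Qed.

Lemma addresses_ex : exists pi rho : nat -> int -> int, [/\
  forall N, cancel (pi N) (rho N), forall N, cancel (rho N) (pi N),
  forall N e, inside N (pi N e) = inside N e &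
  forall N e, inside N (e %/ (rr N)%:Z)%Z -> pi N.+1 e =
    (cpos N (absz (e %% (rr N)%:Z)%Z))%:Z + pi N (e %/ (rr N)%:Z)%Z].
Proof.
pose good N (p : (int -> int) * (int -> int)) := [/\ cancel p.1 p.2,
  cancel p.2 p.1 & forall e, inside N (p.1 e) = inside N e].
pose next N (p p' : (int -> int) * (int -> int)) := forall e,
  inside N (e %/ (rr N)%:Z)%Z -> p'.1 e =
    (cpos N (absz (e %% (rr N)%:Z)%Z))%:Z + p.1 (e %/ (rr N)%:Z)%Z.
(* With the implication under the existential the step is total, so the sequence can be defined by
   [cid] before it is shown to be good. *)
have step N p : exists p', good N p -> good N.+1 p' /\ next N p p'.
  have [[g1 g2 g3]|ng] := pselect (good N p); last by exists p.
  have [pi' [rho' [h1 h2 h3 h4]]] := address_step g1 g3.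
  by exists (pi', rho').
pose F := fix F N := if N is N'.+1 then sval (cid (step N' (F N'))) else (id, id).
have gF N : good N (F N).
  elim: N => [|N ih]; first by split.
  by have [] := svalP (cid (step N (F N))) ih.
have nF N : next N (F N) (F N.+1) by have [] := svalP (cid (step N (F N))) (gF N).
by exists (fun N => (F N).1), (fun N => (F N).2); split;
  [move=> N|move=> N|move=> N|exact: nF]; have [] := gF N.
Qed.

(** As [pi N] preserves the window, the [N]-th column is the interval from [- ell N / RR N] to
    [ell N / RR N]. This bound makes the columns exhaust the line and have unbounded measure. *)
Lemma ell_RR N : (N.+1 * RR N <= ell N)%N.
Proof.
elim: N => [|N ih]; first by rewrite /RR big_ord0.
rewrite RRS ellS /gap; have := pp_gt0 N.
move: ih; move: (RR N) (rr N) (pp N) (ell N) => a r p l ih p0.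
have h1 : (l <= p * l)%N by rewrite leq_pmull.
have h2 : (N.+2 * a <= 2 * (p * l))%N by lia.
have h3 : (N.+2 * (a * r) <= r * (2 * (p * l)))%N.
  by rewrite mulnA [(_ * r)%N]mulnC leq_mul2l h2 orbT.
by rewrite [X in (_ <= X)%N]mulSn -mulnA; lia.
Qed.

(** * The transformation as a shift of heights on the line *)

Section Shift.
Context (R : realType) (pi rho : nat -> int -> int).
Hypothesis piK : forall N, cancel (pi N) (rho N).
Hypothesis rhoK : forall N, cancel (rho N) (pi N).
Hypothesis pi_inside : forall N e, inside N (pi N e) = inside N e.
Hypothesis pi_next : forall N e, inside N (e %/ (rr N)%:Z)%Z -> pi N.+1 e =
    (cpos N (absz (e %% (rr N)%:Z)%Z))%:Z + pi N (e %/ (rr N)%:Z)%Z.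
Implicit Types (x y : R) (N : nat) (e dl : int).

(* The [N]-th address of [x] is the index of the interval of length [1 / RR N]
   containing it; [pi N] sends addresses to heights. *)
Definition addr N x : int := Num.floor (x * (RR N)%:R).

Definition posR N x : int := pi N (addr N x).

Let RR0 N : (0 : R) < (RR N)%:R. Proof. by rewrite ltr0n RR_gt0. Qed.

Lemma addrE N x e : addr N x = e <-> e%:~R <= x * (RR N)%:R < (e + 1)%:~R.
Proof.
rewrite /addr; split=> [<-|]; last exact: floor_def.
by rewrite floor_le_tmp floorD1_gt.
Qed.

Lemma addr_div N x : (addr N.+1 x %/ (rr N)%:Z)%Z = addr N x.
Proof.
symmetry; apply/addrE; have [/(_ erefl) + _] := addrE N.+1 x (addr N.+1 x).
have [] := divz_modz_inside N (addr N.+1 x); move: (addr N.+1 x) => e.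
move: (e %/ (rr N)%:Z)%Z (e %% (rr N)%:Z)%Z => q s eE s0 s1 /andP[h1 h2].
have r0 : (0 : R) < (rr N)%:R by rewrite ltr0n rr_gt0.
move: h1 h2; rewrite RRS natrM mulrA => h1 h2.
rewrite -(ler_pM2r r0) -(ltr_pM2r r0).
have rE : (rr N)%:R = ((rr N)%:Z)%:~R :> R by [].
apply/andP; split.
  by apply: le_trans h1; rewrite rE -intrM ler_int; lia.
apply: (lt_le_trans h2); rewrite rE -intrM ler_int; lia.
Qed.

Lemma posR_next N x : inside N (posR N x) ->
  posR N.+1 x = (cpos N (absz (addr N.+1 x %% (rr N)%:Z)%Z))%:Z + posR N x.
Proof. by rewrite /posR pi_inside => h; rewrite pi_next addr_div. Qed.

Lemma posR_step N f x : inside N f ->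
  posR N x = f <-> exists2 i, (i < rr N)%N & posR N.+1 x = (cpos N i)%:Z + f.
Proof.
move=> fr; have sr e : (absz (e %% (rr N)%:Z)%Z < rr N)%N.
  by have [_ s0 s1] := divz_modz_inside N e; lia.
split=> [xf|[i ir xi]].
  by exists (absz (addr N.+1 x %% (rr N)%:Z)%Z) => //; rewrite posR_next xf.
pose e0 := rho N f; pose e1 := e0 * (rr N)%:Z + i%:Z.
have r0 : (rr N)%:Z != 0 by rewrite eqz_nat -lt0n rr_gt0.
have d1 : (e1 %/ (rr N)%:Z)%Z = e0.
  by rewrite /e1 divzMDl// divz_small ?addr0//; lia.
have m1 : (e1 %% (rr N)%:Z)%Z = i%:Z.
  by rewrite /e1 modzMDl modz_small//; lia.
have : pi N.+1 e1 = posR N.+1 x.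
  by rewrite pi_next d1 ?m1 /e0 ?rhoK//= -pi_inside rhoK.
move=> /(can_inj (piK N.+1)) e1x.
by rewrite /posR -addr_div -e1x d1 /e0 rhoK.
Qed.

Lemma posR_cover x : exists N, inside N (posR N x).
Proof.
pose N := (Num.truncn `|x|).+1; exists N; rewrite /posR pi_inside.
have xN : `|x| < N%:R by rewrite /N truncnS_gt.
have lR : (N%:R * (RR N)%:R : R) < (ell N)%:R.
  rewrite -natrM ltr_nat; have := ell_RR N.
  by have := RR_gt0 N; lia.
have xR : `|x * (RR N)%:R| < (ell N)%:R.
  rewrite normrM (gtr0_norm (RR0 N)); apply: lt_trans lR.
  by rewrite ltr_pM2r.
have [/(_ erefl) + _] := addrE N x (addr N x).
move: xR; rewrite ltr_norml /inside => /andP[x1 x2] /andP[h1 h2].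
apply/andP; split.
  rewrite -ltzD1 -(ltr_int R); apply: le_lt_trans h2.
  by rewrite rmorphN/= ltW.
by rewrite -(ltr_int R); apply: le_lt_trans h1 _.
Qed.

(* Moves [x] up by [dl] levels, keeping its relative place in the level. *)
Definition shift_at dl N x :=
  x + ((rho N (posR N x + dl))%:~R - (addr N x)%:~R) / (RR N)%:R.

Lemma addr_shift_at dl N x : addr N (shift_at dl N x) = rho N (posR N x + dl).
Proof.
apply/addrE; rewrite /shift_at mulrDl divfK ?gt_eqF//.
have [/(_ erefl) + _] := addrE N x (addr N x).
by rewrite !intrD; move: (x * _) => y; lra.
Qed.

Lemma posR_shift_at dl N x : posR N (shift_at dl N x) = posR N x + dl.
Proof. by rewrite {1}/posR addr_shift_at rhoK. Qed.

Definition movable dl N x := inside N (posR N x) && inside N (posR N x + dl).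

(** Passing to the next stage adds to the height a term depending only on the remainder of the
    address modulo [rr N]. A shift inside the [N]-th column changes the quotient alone, so both
    stages translate [x] by the same amount. *)
Lemma movable_next dl N x : movable dl N x ->
  movable dl N.+1 x /\ shift_at dl N.+1 x = shift_at dl N x.
Proof.
move=> /andP[h1 h2].
have sr : (absz (addr N.+1 x %% (rr N)%:Z)%Z < rr N)%N.
  by have [_ s0 s1] := divz_modz_inside N (addr N.+1 x); lia.
have E := posR_next h1; split.
  by rewrite /movable E -addrA; apply/andP; split; exact: inside_cpos.
rewrite /shift_at E -addrA.
have [] := divz_modz_inside N (addr N.+1 x); rewrite addr_div.
set s := (_ %% _)%Z in sr E *; move=> aE s0 s1.
pose e1 := rho N (posR N x + dl) * (rr N)%:Z + s.
have r0 : (rr N)%:Z != 0 by rewrite eqz_nat -lt0n rr_gt0.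
have d1 : (e1 %/ (rr N)%:Z)%Z = rho N (posR N x + dl).
  by rewrite /e1 divzMDl// divz_small ?addr0//; lia.
have m1 : (e1 %% (rr N)%:Z)%Z = s.
  by rewrite /e1 modzMDl modz_small//; lia.
have <- : pi N.+1 e1 = (cpos N (absz s))%:Z + (posR N x + dl).
  by rewrite pi_next d1 ?m1 ?rhoK//= -pi_inside rhoK.
rewrite piK aE /e1 RRS natrM !intrD !intrM; congr (_ + _).
have -> : ((rr N)%:Z)%:~R = (rr N)%:R :> R by [].
have rn : (rr N)%:R != 0 :> R by rewrite pnatr_eq0 -lt0n rr_gt0.
by field; rewrite rn gt_eqF.
Qed.

Lemma movable_le dl N N' x : (N <= N')%N -> movable dl N x ->
  movable dl N' x /\ shift_at dl N' x = shift_at dl N x.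
Proof.
move=> NN' h; rewrite -(subnK NN') addnC; elim: (N' - N)%N => [|k [ih1 ih2]].
  by rewrite addn0.
by rewrite addnS; have [h1 h2] := movable_next ih1; rewrite h2.
Qed.

Lemma movable_ex dl x : `|dl| <= 1 -> exists N, movable dl N x.
Proof.
move=> dl1; have [N xN] := posR_cover x; exists N.+1.
have sr : (absz (addr N.+1 x %% (rr N)%:Z)%Z < rr N)%N.
  by have [_ s0 s1] := divz_modz_inside N (addr N.+1 x); lia.
rewrite /movable (posR_next xN); move: xN sr; rewrite /inside.
move: (absz _) (posR N x) => i f xN ir; have := cpos_top ir; have := gap_ge N.
have := ell_gt0 N; have := ell_mono (leqnSn N); lia.
Qed.

(** Any stage at which [x] is movable gives the same value; the least one is only a choice. For
    [|dl| <= 1] the default [x] is never reached, by [movable_ex]. *)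
Definition shiftR dl x : R :=
  if pselect (exists N, movable dl N x) is left h
  then shift_at dl (ex_minn h) x else x.

Lemma shiftRE dl N x : movable dl N x -> shiftR dl x = shift_at dl N x.
Proof.
move=> h; rewrite /shiftR; case: pselect => [ex|]; last by case; exists N.
case: ex_minnP => N0 h0 N0min; have [NN|NN] := leqP N0 N.
  by have [_ ->] := movable_le NN h0.
by have := N0min _ h; rewrite leqNgt NN.
Qed.

Lemma movable_shift_at dl N x : movable dl N x -> movable (- dl) N (shift_at dl N x).
Proof. by rewrite /movable posR_shift_at addrK andbC. Qed.

Lemma shift_atK dl N x : shift_at (- dl) N (shift_at dl N x) = x.
Proof.
rewrite {1}/shift_at posR_shift_at addrK addr_shift_at /posR piK /shift_at.
by rewrite /posR -[RHS]addr0 -addrA -mulrDl addrA subrK subrr mul0r.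
Qed.

Lemma shiftRK dl : `|dl| <= 1 -> cancel (shiftR dl) (shiftR (- dl)).
Proof.
move=> dl1 x; have [N h] := movable_ex x dl1.
by rewrite (shiftRE h) (shiftRE (movable_shift_at h)) shift_atK.
Qed.

End Shift.

(** * The shift preserves Lebesgue measure on Borel sets *)

Section BorelShift.
Context (R : realType) (pi rho : nat -> int -> int).
Hypothesis piK : forall N, cancel (pi N) (rho N).
Hypothesis rhoK : forall N, cancel (rho N) (pi N).
Hypothesis pi_inside : forall N e, inside N (pi N e) = inside N e.
Hypothesis pi_next : forall N e, inside N (e %/ (rr N)%:Z)%Z -> pi N.+1 e =
    (cpos N (absz (e %% (rr N)%:Z)%Z))%:Z + pi N (e %/ (rr N)%:Z)%Z.

Local Notation lam := (@lebesgue_measure R).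
Local Notation RB := (measurableTypeR R).
Local Notation shift := (@shiftR R pi rho).
Local Notation mov := (@movable R pi).

Lemma measurable_translation (t : R) :
  measurable_fun setT ((fun x => x + t) : RB -> RB).
Proof. by apply: measurable_funD. Qed.

Lemma lebesgue_measure_translation (t : R) (B : set RB) : measurable B ->
  lam ((fun x => x + t) @^-1` B) = lam B.
Proof.
move=> mB; have mt := measurable_translation t.
pose mu := pushforward lam ((fun x => x + t) : RB -> RB).
symmetry; apply: (lebesgue_measure_unique (mu := mu)) => // _ [[a b] _ <-] /=.
rewrite /mu /= /pushforward.
rewrite (_ : _ @^-1` _ = `]a - t, b - t]%classic); last first.
  by apply/seteqP; split => x /=; rewrite !in_itv/= ltrBlDr lerBrDr.
rewrite !lebesgue_measure_itv/= !lte_fin ltrD2r; case: ifP => // _.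
by rewrite -!EFinB opprB addrA subrK.
Qed.

Definition piece N (e : int) : set RB := [set x | addr N x = e].

Lemma pieceE N e :
  piece N e = `[e%:~R / (RR N)%:R, (e + 1)%:~R / (RR N)%:R[%classic.
Proof.
have R0 : (0 : R) < (RR N)%:R by rewrite ltr0n RR_gt0.
apply/seteqP; split => x /=; rewrite in_itv/= ler_pdivrMr// ltr_pdivlMr//.
  by move/addrE.
by move=> h; apply/addrE.
Qed.

Lemma measurable_piece N e : measurable (piece N e).
Proof. by rewrite pieceE; exact: measurable_itv. Qed.

Lemma lebesgue_piece N e : lam (piece N e) = ((RR N)%:R^-1)%:E.
Proof.
have R0 : (0 : R) < (RR N)%:R by rewrite ltr0n RR_gt0.
rewrite pieceE lebesgue_measure_itv/= lte_fin ltr_pM2r ?invr_gt0//.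
rewrite ltr_int ltzD1 lexx -EFinB -mulrBl intrD addrAC subrr add0r.
by rewrite mul1r.
Qed.

Definition piece_movable dl N e := inside N (pi N e) && inside N (pi N e + dl).

(** On a piece of fixed address the shift is a translation by [t N i], and the movable pieces of all
    stages form a countable cover. *)
Lemma measurable_shift (dl : int) (B : set RB) : `|dl| <= 1 -> measurable B ->
  measurable (shift dl @^-1` B : set RB).
Proof.
move=> dl1 mB.
pose e N i : int := i%:Z - (ell N)%:Z.
pose t N i : R := ((rho N (pi N (e N i) + dl))%:~R - (e N i)%:~R) / (RR N)%:R.
rewrite (_ : _ @^-1` _ = \bigcup_N \bigcup_(i in [set i | piece_movable dl N (e N i)])
    (piece N (e N i) `&` (fun x => x + t N i) @^-1` B)).
  apply: bigcupT_measurable => N; apply: bigcup_measurable => i _.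
  apply: measurableI; first exact: measurable_piece.
  by rewrite -[X in measurable X]setTI; exact: measurable_translation.
apply/seteqP; split => x /=.
  move=> Bx; have [N xN] := movable_ex pi_inside pi_next x dl1.
  have [x1 x2] := andP xN; have := x1; rewrite /posR pi_inside /inside => x3.
  exists N => //; pose i := absz (addr N x + (ell N)%:Z).
  have iE : e N i = addr N x by rewrite /e /i; lia.
  exists i; rewrite /= iE; first exact: xN.
  split => //=; rewrite /t iE.
  by move: Bx; rewrite (shiftRE piK rhoK pi_inside pi_next xN).
move=> [N _ [i /= im [xi]]]; rewrite /piece /= in xi.
have xN : mov dl N x by rewrite /movable /posR xi.
by rewrite /= (shiftRE piK rhoK pi_inside pi_next xN) /shift_at /posR xi.
Qed.

(** Pieces are taken in the target: on [C N] the inverse shift is already defined at stage [N] and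
    translates each piece, so preimages of subsets of a piece are translates. The sets [C N]
    increase to the line, and continuity from below concludes. *)
Lemma lebesgue_shift (dl : int) (B : set RB) : `|dl| <= 1 -> measurable B ->
  lam (shift dl @^-1` B) = lam B.
Proof.
move=> dl1 mB; have dl1' : `|- dl| <= 1 by rewrite normrN.
pose T : RB -> RB := shift dl; pose S : RB -> RB := shift (- dl).
have TK : cancel T S by exact: shiftRK.
have SK : cancel S T by have := @shiftRK R _ _ piK rhoK pi_inside pi_next _ dl1'; rewrite opprK.
pose C N : set RB := [set x | mov (- dl) N x].
pose e N i : int := i%:Z - (ell N)%:Z.
pose t N i : R := - (((rho N (pi N (e N i) - dl))%:~R - (e N i)%:~R) / (RR N)%:R).
have mC N : measurable (C N).
  rewrite (_ : C N = \bigcup_(i in [set i | piece_movable (- dl) N (e N i)]) piece N (e N i)).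
    by apply: bigcup_measurable => i _; exact: measurable_piece.
  apply/seteqP; split => x /=.
    move=> xN; have [+ _] := andP xN; rewrite /posR pi_inside /inside => x3.
    have iE : e N (absz (addr N x + (ell N)%:Z)) = addr N x by rewrite /e; lia.
    by exists (absz (addr N x + (ell N)%:Z)); rewrite /piece /= iE.
  by move=> [i /= im xi]; rewrite /C /= /movable /posR xi.
have mBC N : measurable (B `&` C N) by exact: measurableI.
have mT A : measurable A -> measurable (T @^-1` A : set RB) by exact: measurable_shift.
have BCi N i : T @^-1` (B `&` C N `&` piece N (e N i)) =
    (fun x => x + t N i) @^-1` (B `&` C N `&` piece N (e N i)).
  have Sx x : C N x -> piece N (e N i) x -> S x = x - t N i.
    move=> xC xi; rewrite /S (shiftRE piK rhoK pi_inside pi_next xC) /shift_at.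
    by rewrite /t /posR xi opprK.
  apply/seteqP; split => y /= [[Bx Cx] px].
    have -> : y + t N i = T y by rewrite -{1}(TK y) (Sx (T y))// subrK.
    by [].
  have -> : T y = y + t N i; last by [].
  by rewrite -(SK (y + t N i)) Sx// addrK.
have pd N i j x : (i < j < 2 * ell N)%N -> piece N (e N i) x -> piece N (e N j) x -> False.
  by rewrite /piece /= /e => /andP[ij _] ->; lia.
have cov N x : C N x -> exists2 i, (i < 2 * ell N)%N & piece N (e N i) x.
  move=> xN; have [+ _] := andP xN; rewrite /posR pi_inside /inside => x3.
  exists (absz (addr N x + (ell N)%:Z)); first by lia.
  by rewrite /piece /= /e; lia.
have fp N i : fin_meas lam (piece N (e N i)).
  have h : (lam (piece N (e N i)) < +oo)%E by rewrite lebesgue_piece ltry.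
  by split; [exact: measurable_piece|exact: h].
have eqN N : lam (T @^-1` (B `&` C N)) = lam (B `&` C N).
  have fBC : fin_meas lam (B `&` C N).
    apply: (fin_meas_sub (fin_meas_bigcup (n := (2 * ell N)%N) (fun i _ => fp N i))) => //.
    by move=> x [_ /cov[i iN xi]]; exists i.
  have fBCi i : fin_meas lam (B `&` C N `&` piece N (e N i)).
    by apply: fin_measI => //; exact: measurable_piece.
  have lT i : lam (T @^-1` (B `&` C N `&` piece N (e N i))) =
      lam (B `&` C N `&` piece N (e N i)).
    by rewrite BCi lebesgue_measure_translation//; case: (fBCi i).
  have fTi i : fin_meas lam (T @^-1` (B `&` C N `&` piece N (e N i))).
    have [h1 h2] := fBCi i; split; first exact: mT.
    by apply: le_lt_trans h2; rewrite le_eqVlt; apply/orP; left; apply/eqP; exact: lT.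
  have fT : fin_meas lam (T @^-1` (B `&` C N)).
    apply: (fin_meas_sub (fin_meas_bigcup (n := (2 * ell N)%N) (fun i _ => fTi i))).
      exact: (mT _ (mBC N)).
    by move=> x /= [Bx Cx]; have [i iN xi] := cov _ _ Cx; exists i.
  apply: (etrans (fin_measE fT)); apply: (etrans _ (esym (fin_measE fBC))); congr (_%:E).
  rewrite -(sum_meas_cover (n := (2 * ell N)%N) (F := fun i => piece N (e N i)) fBC); first last.
  - by move=> x [_ /cov[i iN xi]]; exists i.
  - exact: pd.
  - by move=> i _; exact: measurable_piece.
  rewrite -(sum_meas_cover (n := (2 * ell N)%N) (F := fun i => T @^-1` piece N (e N i)) fT); first last.
  - by move=> x /= [_ /cov[i iN xi]]; exists i.
  - by move=> i j x ij /=; exact: pd ij.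
  - by move=> i _; apply: mT; exact: measurable_piece.
  by apply: eq_bigr => i _; rewrite -preimage_setI; exact: congr1 (lT i).
have Bcup : \bigcup_N (B `&` C N) = B.
  rewrite -setI_bigcupr setIidl// => x _.
  by have [N xN] := movable_ex pi_inside pi_next x dl1'; exists N.
have homo1 : {homo (fun N => B `&` C N) : n n' / (n <= n')%N >-> (n <= n')%O}.
  move=> n n' nn; apply/subsetPset => x [Bx Cx]; split => //.
  by have [] := movable_le piK rhoK pi_inside pi_next nn Cx.
have homo2 : {homo (fun N => T @^-1` (B `&` C N)) : n n' / (n <= n')%N >-> (n <= n')%O}.
  move=> n n' nn; apply/subsetPset => x /=; have /subsetPset := homo1 _ _ nn; exact.
have c1 := nondecreasing_cvg_mu (mu := lam) mBC _ homo1.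
have c2 := nondecreasing_cvg_mu (mu := lam) (fun N => mT _ (mBC N)) _ homo2.
rewrite -preimage_bigcup Bcup in c2; rewrite Bcup in c1.
have {}c1 := c1 mB; have {}c2 := c2 (mT _ mB).
transitivity (limn (lam \o (fun N => T @^-1` (B `&` C N)))).
  by apply/esym/cvg_lim => //; exact: c2.
transitivity (limn (lam \o (fun N => B `&` C N))); last by apply/cvg_lim => //; exact: c1.
by congr (limn _); apply/funext => N /=; exact: eqN.
Qed.

End BorelShift.

(** * The measure space of a tower: sigma-finite, infinite, nonatomic *)

Section TowerSpace.
Context d (X : measurableType d) (R : realType) (mu : {measure set X -> \bar R}).
Local Notation m := (meas mu).
Variables (T S : X -> X) (pos : nat -> X -> int).
Hypothesis tow : tower mu T S pos.
Local Notation col := (column pos).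
Local Notation levi := (nth_level pos).

Lemma tower_sigma_finite : sigma_finite setT mu.
Proof.
exists col; last by move=> N; exact: fin_meas_col tow N.
by apply/esym/seteqP; split => // x _; have [N xN] := tow_cover tow x; exists N.
Qed.

Lemma tower_infinite : mu setT = +oo%E.
Proof.
apply/eqP; rewrite -leye_eq leNgt; apply/negP => Xoo.
have fX : fin_meas mu setT by split.
pose N := (Num.truncn (m setT)).+1.
have : m (col N) <= m setT by apply: le_meas => //; case: (fin_meas_col tow N).
have R0 : (0 : R) < (RR N)%:R by rewrite ltr0n RR_gt0.
rewrite (meas_col tow) /width ler_pdivrMr// leNgt => /negP; apply.
apply: (@lt_le_trans _ _ (N%:R * (RR N)%:R)).
  by rewrite ltr_pM2r// truncnS_gt.
rewrite -natrM ler_nat; apply: leq_trans (leq_pmull _ _) => //.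
by apply: leq_trans (ell_RR N); rewrite leq_mul2r leqnSn orbT.
Qed.

(** Since the widths tend to 0, some level meets the set in positive measure and is itself smaller
    than the set. *)
Lemma tower_nonatomic : nonatomic mu.
Proof.
move=> A mA A0.
have [N N0] : exists N, 0 < m (A `&` col N).
  apply: contrapT => /forallNP h; move: A0; rewrite (mu_cover0 tow mA) ?ltxx// => N.
  by apply/eqP; rewrite eq_le meas_ge0 andbT leNgt; apply/negP; exact: h.
have fA := fin_measIr (fin_meas_col tow N) mA.
pose K := (Num.truncn (m (A `&` col N))^-1).+1; pose M := maxn N K.
have wM : width R M < m (A `&` col N).
  rewrite -[ltRHS]invrK /width ltf_pV2 ?posrE ?invr_gt0 ?ltr0n ?RR_gt0//.
  apply: (@lt_le_trans _ _ K%:R); first by rewrite truncnS_gt.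
  by rewrite ler_nat; apply: leq_trans (RR_ge M); exact: leq_maxr.
have AM : A `&` col N `<=` col M.
  by move=> x [_]; exact: (sub_col tow (leq_maxl N K)).
have [i i0] : exists i : 'I_(2 * ell M), 0 < m (A `&` col N `&` levi M i).
  apply: contrapT => /forallNP h; move: N0; rewrite (meas_levels tow fA AM) big1 ?ltxx// => i _.
  by apply/eqP; rewrite eq_le meas_ge0 andbT leNgt; apply/negP; exact: h.
have fl := fin_meas_lev tow M (i%:Z - (ell M)%:Z); have [ml _] := fl.
have fB : fin_meas mu (A `&` col N `&` levi M i) by exact: fin_measI.
exists (A `&` col N `&` levi M i); split.
- by case: fB.
- by move=> x [[]].
- by rewrite (fin_measE fB) lte_fin.
- apply: (@lt_le_trans _ _ (mu (A `&` col N))).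
    rewrite (fin_measE fB) (fin_measE fA) lte_fin; apply: le_lt_trans wM.
    by rewrite -(meas_lev tow M (i%:Z - (ell M)%:Z)); apply: le_meas => //; case: fB.
  by apply: le_measure; rewrite ?inE//; case: fA.
Qed.

End TowerSpace.

(** * From Borel sets to the completed Lebesgue measure *)

Section Completion.
Context (R : realType).
Local Notation lam := (@lebesgue_measure R).
Local Notation RB := (measurableTypeR R).
Local Notation cmu := (@completed_lebesgue_measure R).

Local Notation XC := (caratheodory_type ((@wlength R idfun)^*)%mu).

Lemma completed_measurableE :
  (measurable : set (set XC)) = completed_algebra_gen lam.
Proof.
by rewrite -g_sigma_completed_algebra_genE completed_caratheodory_measurable.
Qed.

Lemma completedP (A : set R) : measurable (A : set XC) <->
  exists B M : set RB, [/\ measurable B, measurable M, lam M = 0%E, B `<=` A &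
    A `<=` B `|` M].
Proof.
rewrite completed_measurableE; split.
  move=> [B mB [N [M [mM M0 NM]]] <-]; exists B, M; split => //.
  by move=> x [Bx|/NM Mx]; [left|right].
move=> [B [M [mB mM M0 BA AB]]]; exists B => //; exists (A `&` M).
  by exists M; split => // x [].
apply/seteqP; split => x; first by case=> [/BA//|[]].
by move=> Ax; have [Bx|Mx] := AB _ Ax; [left|right].
Qed.

Lemma measurable_completed (B : set RB) : measurable B -> measurable (B : set XC).
Proof.
move=> mB; apply/completedP; by exists B, set0; split => //; exact: measure0.
Qed.

Lemma completedE (A : set R) (B M : set RB) : measurable B -> measurable M ->
  lam M = 0%E -> B `<=` A -> A `<=` B `|` M -> cmu A = lam B.
Proof.
move=> mB mM M0 BA AB; apply/eqP; rewrite eq_le; apply/andP; split.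
  have h : (cmu A <= cmu (B `|` M))%E by exact: le_outer_measure.
  apply: (le_trans h); have h' := measureU2 lam mB mM.
  by apply: (le_trans h'); rewrite [X in (_ + X)%E]M0 adde0.
by have h : (cmu B <= cmu A)%E by exact: le_outer_measure.
Qed.

(** A Borel set inside [A] that exhausts it up to a null Borel set pulls back to one for the
    preimage, so measurability and invariance extend to the completion. *)
Lemma completed_preimage (f : R -> R) :
  (forall B : set RB, measurable B -> measurable (f @^-1` B : set RB)) ->
  (forall B : set RB, measurable B -> lam (f @^-1` B) = lam B) ->
  forall A : set XC, measurable A ->
    measurable (f @^-1` A : set XC) /\ cmu (f @^-1` A) = cmu A.
Proof.
move=> mf lf A /completedP[B [M [mB mM M0 BA AB]]].
have BA' : f @^-1` B `<=` f @^-1` A by move=> x /=; exact: BA.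
have AB' : f @^-1` A `<=` f @^-1` B `|` f @^-1` M by move=> x /AB.
have M0' : lam (f @^-1` M) = 0%E by rewrite lf.
split; last first.
  by rewrite (completedE mB mM M0 BA AB) (completedE (mf _ mB) (mf _ mM) M0' BA' AB') lf.
by apply/completedP; exists (f @^-1` B), (f @^-1` M); split => //; exact: mf.
Qed.

Lemma completed_lebesgue_space : lebesgue_space cmu.
Proof.
exists lam; split.
  exists setT, set0, (fun _ => 0); split => //; first by rewrite setI0.
  by move=> B mB; rewrite setI0 esum_set0 adde0 setIT.
exists set0, id; split.
- exact: negligible_set0.
- by [].
- by rewrite setC0 image_id setCT; exact: negligible_set0.
- by move=> A; rewrite image_id setD0 completed_measurableE.
- by move=> B mB; rewrite setD0 preimage_id.
Qed.

End Completion.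

(** * The shift on the line forms a tower *)

Section Construction.
Context (R : realType) (pi rho : nat -> int -> int).
Hypothesis piK : forall N, cancel (pi N) (rho N).
Hypothesis rhoK : forall N, cancel (rho N) (pi N).
Hypothesis pi_inside : forall N e, inside N (pi N e) = inside N e.
Hypothesis pi_next : forall N e, inside N (e %/ (rr N)%:Z)%Z -> pi N.+1 e =
    (cpos N (absz (e %% (rr N)%:Z)%Z))%:Z + pi N (e %/ (rr N)%:Z)%Z.

Local Notation lam := (@lebesgue_measure R).
Local Notation RB := (measurableTypeR R).
Local Notation cmu := (@completed_lebesgue_measure R).
Local Notation XC := (caratheodory_type ((@wlength R idfun)^*)%mu).
Local Notation posn := (@posR R pi).

Lemma lev_piece N f : lev posn N f = piece N (rho N f).
Proof.
apply/seteqP; split => x; rewrite /lev /piece /posR /=.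
  by move=> <-; rewrite piK.
by move=> ->; rewrite rhoK.
Qed.

Lemma measurable_lset N P : measurable (lset posn N P : set RB).
Proof.
rewrite lset_setU; apply: bigcup_measurable => i _.
by rewrite /nth_level lev_piece; exact: measurable_piece.
Qed.

Lemma inside_le N N' x : (N <= N')%N -> inside N (posn N x) -> inside N' (posn N' x).
Proof.
move=> NN' h; have h0 : movable pi 0 N x by rewrite /movable addr0 h.
by have [/andP[]] := movable_le piK rhoK pi_inside pi_next NN' h0.
Qed.

Lemma lev_next N x : inside N (posn N x) ->
  lev posn N.+1 (posn N.+1 x) `<=` lev posn N (posn N x).
Proof.
move=> xN y; rewrite /lev /= => yx.
have [/(_ erefl)[i ir E] _] := posR_step piK rhoK pi_inside pi_next x xN.
have [_ h] := posR_step piK rhoK pi_inside pi_next y xN.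
by apply: h; exists i => //; rewrite yx.
Qed.

(** Approximation of an open set from inside by levels. Levels are intervals of length [1 / RR N],
    and each is refined by the next stage, so these sets increase to [U]. *)
Definition inner (U : set R) N := lset posn N [set f | lev posn N f `<=` U].

Lemma inner_sub U N : inner U N `<=` U.
Proof. by move=> x [_ /= h]; exact: h. Qed.

Lemma inner_cover U : open U -> \bigcup_N inner U N = U.
Proof.
move=> oU; apply/seteqP; split => [x [N _]|x Ux]; first exact: inner_sub.
have /nbhs_ballP[e /= e0 eU] : nbhs x U by exact: open_nbhs_nbhs.
have [N0 xN0] := posR_cover pi_inside x.
pose N := maxn N0 (Num.truncn e^-1).+1.
have xN : inside N (posn N x) by apply: inside_le xN0; exact: leq_maxl.
exists N => //; split => // y; rewrite /lev /posR /= => /(can_inj (piK N)) yx.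
apply: eU; rewrite /ball/=.
have R0 : (0 : R) < (RR N)%:R by rewrite ltr0n RR_gt0.
have Re : 1 < e * (RR N)%:R.
  rewrite mulrC -ltr_pdivrMr// mul1r; apply: (lt_le_trans (truncnS_gt _)).
  by rewrite ler_nat; apply: leq_trans (RR_ge N); exact: leq_maxr.
have [/(_ erefl) + _] := addrE N x (addr N x).
have [/(_ yx) + _] := addrE N y (addr N x).
rewrite intrD => /andP[y1 y2] /andP[x1 x2].
rewrite -(ltr_pM2r R0) -[X in _ * X < _](gtr0_norm R0) -normrM mulrBl.
rewrite ltr_norml; apply/andP; split; lra.
Qed.

Lemma inner_approx (U : set RB) (e : R) : open (U : set R) -> (lam U < +oo)%E -> 0 < e ->
  exists N, (lam (U `\` inner U N) < e%:E)%E.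
Proof.
move=> oU Uoo e0; have mU : measurable U by exact: open_measurable.
have fU : fin_meas lam U by split.
have mI N : measurable (inner U N : set RB) by exact: measurable_lset.
have IU N : inner U N `<=` U by exact: inner_sub.
have fI N : fin_meas lam (inner U N) by apply: (fin_meas_sub fU).
have homo1 : {homo inner U : n n' / (n <= n')%N >-> (n <= n')%O}.
  apply: homo_leq => [//|y x z|N]; first exact: le_trans.
  apply/subsetPset => x [xN /= h]; split; first exact: inside_le xN.
  by move=> y /(lev_next xN) /h.
have c := nondecreasing_cvg_mu (mu := lam) mI _ homo1.
rewrite inner_cover// in c; have {}c := c mU.
have {}c : meas lam (inner U N) @[N --> \oo] --> meas lam U.
  apply: fine_cvg; have E : (lam U = (meas lam U)%:E)%E by exact: (fin_measE fU).
  by rewrite -E.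
have /cvgrPdist_lt/(_ _ e0)[N _ /(_ N (leqnn N))] /= := c.
have UN := meas_split fU (mI N); rewrite setIidr// in UN.
have fD := fin_measD fU (mI N).
rewrite UN [_ + _ - _](_ : _ = meas lam (U `\` inner U N)); last by ring.
rewrite ger0_norm ?meas_ge0// => h; exists N.
have E : (lam (U `\` inner U N) = (meas lam (U `\` inner U N))%:E)%E by exact: (fin_measE fD).
by rewrite E lte_fin.
Qed.

Lemma approx_levels (A : set XC) (e : R) : fin_meas cmu A -> 0 < e -> exists N P,
  meas cmu (A `\` lset posn N P) + meas cmu (lset posn N P `\` A) < e.
Proof.
move=> fA e0; have [mA Aoo] := fA; have e20 : 0 < e / 2 by rewrite divr_gt0.
have [B [M [mB mM M0 BA AB]]] := (completedP A).1 mA.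
have lB : (lam B < +oo)%E by rewrite -(completedE mB mM M0 BA AB).
(* Half of [e] is spent on passing from the Borel part [B] to an open superset [U], and half on
   passing from [U] to finitely many levels inside it; the null set [M] costs nothing. *)
have [U [oU BU UB]] := lebesgue_regularity_outer mB lB e20.
have mU : measurable (U : set RB) by exact: open_measurable.
have Uoo : (lam U < +oo)%E.
  have UE : U `<=` B `|` (U `\` B).
    by move=> x Ux; have [Bx|Bx] := pselect (B x); [left|right].
  have mUB : measurable (U `\` B : set RB) by exact: measurableD.
  have h1 : (lam U <= lam (B `|` (U `\` B)))%E.
    by apply: le_measure; rewrite ?inE//; exact: measurableU.
  have h2 := measureU2 lam mB mUB.
  apply: (le_lt_trans h1); apply: (le_lt_trans h2).
  by rewrite lte_add_pinfty//; apply: (lt_trans UB); rewrite ltry.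
have [N UN] := inner_approx oU Uoo e20.
exists N, [set f | lev posn N f `<=` U]; rewrite -/(inner U N).
have mI : measurable (inner U N : set RB) by exact: measurable_lset.
have mUI : measurable (U `\` inner U N : set RB) by exact: measurableD.
have mUB : measurable (U `\` B : set RB) by exact: measurableD.
have cE (Z : set RB) : cmu Z = lam Z by [].
have small (Z : set XC) (W : set RB) : (lam W < (e / 2)%:E)%E -> (cmu Z <= lam W)%E ->
    meas cmu Z < e / 2.
  move=> We ZW; have Ze := le_lt_trans ZW We.
  have fin : cmu Z \is a fin_num.
    by rewrite ge0_fin_numE ?outer_measure_ge0//; apply: lt_trans Ze _; rewrite ltry.
  by rewrite /meas -lte_fin fineK.
have h1 : meas cmu (A `\` inner U N) < e / 2.
  apply: (small _ (U `\` inner U N)) => //.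
  have sub : A `\` inner U N `<=` (U `\` inner U N) `|` M.
    move=> x [Ax nx]; have [Bx|Mx] := AB _ Ax; last by right.
    by left; split => //; exact: BU.
  have k1 : (cmu (A `\` inner U N) <= cmu ((U `\` inner U N) `|` M))%E.
    exact: le_outer_measure.
  apply: (le_trans k1); rewrite cE; have k2 := measureU2 lam mUI mM.
  by apply: (le_trans k2); rewrite [X in (_ + X)%E]M0 adde0.
have h2 : meas cmu (inner U N `\` A) < e / 2.
  apply: (small _ (U `\` B)) => //.
  have sub : inner U N `\` A `<=` U `\` B.
    by move=> x [/inner_sub Ux nA]; split => // /BA.
  have k1 : (cmu (inner U N `\` A) <= cmu (U `\` B))%E by exact: le_outer_measure.
  exact: k1.
by rewrite [ltRHS]splitr ltrD.
Qed.

Lemma shift_tower : tower cmu (shiftR pi rho 1 : XC -> XC) (shiftR pi rho (-1)) posn.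
Proof.
have d1 : `|1 : int| <= 1 by [].
have d1' : `|-1 : int| <= 1 by [].
have mS dl : `|dl| <= 1 -> forall A : set XC, measurable A ->
    measurable (shiftR pi rho dl @^-1` A : set XC) /\ cmu (shiftR pi rho dl @^-1` A) = cmu A.
  move=> dl1; apply: completed_preimage => B mB.
    exact: measurable_shift.
  exact: lebesgue_shift.
split.
- split.
  + exact: shiftRK.
  + by have := @shiftRK R _ _ piK rhoK pi_inside pi_next _ d1'; rewrite opprK.
  + by move=> _ A mA; rewrite setTI; have [] := mS _ d1 _ mA.
  + by move=> _ A mA; rewrite setTI; have [] := mS _ d1' _ mA.
  + by move=> A mA; have [] := mS _ d1 _ mA.
- move=> N f; rewrite (lev_piece N f : @lev _ XC posn N f = piece N (rho N f)); split.
    by apply: measurable_completed; exact: measurable_piece.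
  exact: lebesgue_piece.
- by move=> N f x fr; exact: posR_step.
- move=> N x h1 h2; rewrite (shiftRE piK rhoK pi_inside pi_next (N := N)) ?posR_shift_at//.
  by rewrite /movable h1.
- move=> N x h1 h2; rewrite (shiftRE piK rhoK pi_inside pi_next (N := N)) ?posR_shift_at//.
  by rewrite /movable h1.
- by move=> x; exact: posR_cover.
- exact: approx_levels.
Qed.

End Construction.

Local Open Scope ereal_scope.

Theorem corollary3p4 (R : realType) :
  exists (d : measure_display) (X : measurableType d)
         (mu : {measure set X -> \bar R}) (T : X -> X),
    [/\ lebesgue_space mu, sigma_finite setT mu, nonatomic mu
      & mu setT = +oo] /\
    [/\ invertible_measure_preserving mu T, weakly_rationally_ergodic mu T
      & ~ rationally_ergodic mu T].
Proof.
have [pi [rho [piK rhoK pi_in pi_nx]]] := addresses_ex.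
have tow := @shift_tower R _ _ piK rhoK pi_in pi_nx.
have [TK SK mT mS muT] := tow_mp tow; have na := tower_nonatomic tow.
do 4!eexists; split; split.
- exact: completed_lebesgue_space.
- exact: tower_sigma_finite tow.
- exact: na.
- exact: tower_infinite tow.
- by split; [exists (shiftR pi rho (-1)); split; [exact: TK|..]|..].
- exact: tower_weakly_rationally_ergodic tow na.
- exact: not_rationally_ergodic tow.
Qed.
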